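(* Suppose the weighted composition operators $C_{\phi,\omega}$ and $C_{\phi_i,\omega_i}$ ($i=1,2$) in $L^2(\mu)$ are densely defined, and fix $\lambda\in(0,1)$. Then $\mathcal{M}_\lambda(C_{\phi_1,\omega_1},C_{\phi_2,\omega_2})$ is closed. In particular, $\mathcal{M}_\lambda(C_{\phi,\omega})$ is closed.
   Context: $(X,\mathscr{A},\mu)$ is a $\sigma$-finite measure space and $L^2(\mu)$ is the complex Hilbert space. For an $\mathscr{A}$-measurable transformation $\phi:X\to X$ and an $\mathscr{A}$-measurable $\omega:X\to\mathbb{C}$, put $\mu_\omega(\Delta)=\int_\Delta|\omega|^2d\mu$. The weighted composition operator $C_{\phi,\omega}$ in $L^2(\mu)$ has domain $\{f\in L^2(\mu):\omega\cdot(f\circ\phi)\in L^2(\mu)\}$ and acts by $C_{\phi,\omega}f=\omega\cdot(f\circ\phi)$. It is always assumed that $\mu_\omega\circ\phi^{-1}\ll\mu$ (so $C_{\phi,\omega}$ is well-defined). A pair $\mathbf{T}=(T_1,T_2)$ of operators in $L^2(\mu)$ is identified with the column operator $f\mapsto\binom{T_1f}{T_2f}$ with domain $\mathcal{D}(T_1)\cap\mathcal{D}(T_2)$; it is closed if its joint graph $\{(f,T_1f,T_2f):f\in\mathcal{D}(\mathbf{T})\}$ is closed in $L^2(\mu)^3$. If $C_{\phi_1,\omega_1},C_{\phi_2,\omega_2}$ are densely defined, the column operator $\mathbf{C}_{\phi,\omega}=(C_{\phi_1,\omega_1},C_{\phi_2,\omega_2})$ is densely defined and closed; let $\mathbf{C}_{\phi,\omega}=\binom{U_1}{U_2}|\mathbf{C}_{\phi,\omega}|$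 be its polar decomposition. The $\lambda$-spherical mean transform is $$\mathcal{M}_\lambda(\mathbf{C}_{\phi,\omega})=\big(\lambda U_1|\mathbf{C}_{\phi,\omega}|+(1-\lambda)|\mathbf{C}_{\phi,\omega}|U_1,\ \lambda U_2|\mathbf{C}_{\phi,\omega}|+(1-\lambda)|\mathbf{C}_{\phi,\omega}|U_2\big),$$ with the natural domains of sums and products. For a single densely defined $C_{\phi,\omega}$ (which is always closed) with polar decomposition $C_{\phi,\omega}=U|C_{\phi,\omega}|$, the $\lambda$-mean transform is $\mathcal{M}_\lambda(C_{\phi,\omega})=\lambda U|C_{\phi,\omega}|+(1-\lambda)|C_{\phi,\omega}|U$. *)

(* Defs.v *)
From HB Require Import structures.
From mathcomp Require Import all_boot all_order all_algebra generic_quotient.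
From mathcomp Require Import complex ring.
From mathcomp Require Import all_classical all_reals all_analysis measurable_realfun.

Set Implicit Arguments.
Unset Strict Implicit.
Unset Printing Implicit Defensive.

Import Order.TTheory GRing.Theory Num.Theory numFieldNormedType.Exports.
Import Normc.

Local Open Scope classical_set_scope.
Local Open Scope ring_scope.
Local Open Scope complex_scope.

Section complex_measurable.
Context d (X : measurableType d) (R : realType).
Implicit Types f g : X -> R[i].

(* Borel measurability of a complex function, R[i] being identified with the
   real plane. *)
Definition cmeasurable f :=
  measurable_fun setT (fun x => complex.Re (f x)) /\
  measurable_fun setT (fun x => complex.Im (f x)).

Lemma normcE (z : R[i]) :
  normc z = Num.sqrt (complex.Re z ^+ 2 + complex.Im z ^+ 2).
Proof. by case: z. Qed.

Lemma normc_ge0 (z : R[i]) : 0 <= normc z.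
Proof. by rewrite normcE sqrtr_ge0. Qed.

Lemma cmeasurable_normc f : cmeasurable f ->
  measurable_fun setT (fun x => normc (f x)).
Proof.
move=> [mr mi]; under eq_fun do rewrite normcE.
apply: (@measurableT_comp _ _ _ _ _ _ (@Num.sqrt R)).
  by apply: continuous_measurable_fun => x; exact: sqrt_continuous.
by apply: measurable_funD; exact: measurable_funX.
Qed.

Lemma cmeasurableD f g : cmeasurable f -> cmeasurable g ->
  cmeasurable (fun x => f x + g x).
Proof.
move=> [fr fi] [gr gi]; split.
- rewrite (_ : (fun x => _) =
    (fun x => complex.Re (f x) + complex.Re (g x))); last first.
    by apply/funext => x; case: (f x) (g x) => [? ?] [].
  exact: measurable_funD.
- rewrite (_ : (fun x => _) =
    (fun x => complex.Im (f x) + complex.Im (g x))); last first.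
    by apply/funext => x; case: (f x) (g x) => [? ?] [].
  exact: measurable_funD.
Qed.

Lemma cmeasurableZ (a : R[i]) f : cmeasurable f ->
  cmeasurable (fun x => a * f x).
Proof.
case: a => ar ai [fr fi]; split.
- rewrite (_ : (fun x => _) =
    (fun x => ar * complex.Re (f x) - ai * complex.Im (f x))); last first.
    by apply/funext => x /=; case: (f x).
  by apply: measurable_funB; apply: measurable_funM.
- rewrite (_ : (fun x => _) =
    (fun x => ar * complex.Im (f x) + ai * complex.Re (f x))); last first.
    by apply/funext => x /=; case: (f x).
  by apply: measurable_funD; apply: measurable_funM.
Qed.

End complex_measurable.

Section complex_L2_functions.
Context d (X : measurableType d) (R : realType).
Variable mu : {measure set X -> \bar R}.

(* The regular module R[i]^o makes X -> R[i]^o an lmodType over R[i]. *)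
Definition L2pred : {pred X -> R[i]^o} :=
  mem [set f : X -> R[i]^o | cmeasurable f /\ @normc R \o f \in Lfun mu 2%:E].

Lemma le_normc_Lnorm2 (f : X -> R[i]) (g : X -> R) : cmeasurable f ->
  measurable_fun setT g -> (forall x, normc (f x) <= g x) ->
  ('N[mu]_2%:E[EFin \o (@normc R \o f)] <= 'N[mu]_2%:E[EFin \o g])%E.
Proof.
move=> mf mg fg; rewrite unlock.
have mP (h : X -> R) : measurable_fun setT h ->
    measurable_fun setT (fun x => `|(h x)%:E| `^ 2)%E.
  move=> mh; apply/measurable_EFinP.
  apply: (@measurableT_comp _ _ _ _ _ _ (fun x : R => x `^ 2)).
    exact: measurable_powR.
  exact: measurableT_comp.
apply: gt0_ler_poweR; first by rewrite invr_ge0.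
- by rewrite in_itv/= leey integral_ge0// => x _; exact: poweR_ge0.
- by rewrite in_itv/= leey integral_ge0// => x _; exact: poweR_ge0.
- apply: ge0_le_integral => //=.
  + exact/mP/cmeasurable_normc.
  + exact: mP.
  + move=> x _; have n0 := normc_ge0 (f x); have g0 := le_trans n0 (fg x).
    by rewrite lee_fin !ger0_norm// !powR_mulrn// ler_pXn2r.
Qed.

Lemma normc_Lfun2_mono (f : X -> R[i]) (g : X -> R) : cmeasurable f ->
  g \in Lfun mu 2%:E -> (forall x, normc (f x) <= g x) ->
  @normc R \o f \in Lfun mu 2%:E.
Proof.
rewrite !inE => mf /andP[+ +] fg; rewrite !inE => mg g2.
apply/andP; rewrite !inE; split; first exact: cmeasurable_normc.
by apply: le_lt_trans g2; exact: le_normc_Lnorm2.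
Qed.

Lemma normcD_le (x y : R[i]) : normc (x + y) <= normc x + normc y.
Proof. by rewrite -lecR rmorphD; exact: (@ler_normD _ R[i]). Qed.

Lemma Lfun2_submod : submod_closed (Lfun mu 2%:E).
Proof. by apply: Lfun_submod_closed; rewrite lee_fin ler1n. Qed.

Lemma L2pred_submod : submod_closed L2pred.
Proof.
have [L0 LD] := Lfun2_submod.
split.
  apply/mem_set => /=.
  have m0 : cmeasurable (0 : X -> R[i]) by split; exact: measurable_cst.
  split=> //; apply: (@normc_Lfun2_mono _ 0) => //.
  by move=> x; rewrite [X in X <= _]normc0.
move=> a f g /set_mem[mf lf] /set_mem[mg lg]; apply/mem_set.
have mh : cmeasurable (a *: f + g).
  by apply: cmeasurableD => //; exact: cmeasurableZ.
split=> //.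
apply: (@normc_Lfun2_mono _ (fun x => normc a * normc (f x) + normc (g x))) => //.
  exact: (LD (normc a) _ _ lf lg).
by move=> x; rewrite (le_trans (normcD_le _ _))// lerD2r normcM.
Qed.

HB.instance Definition _ := GRing.isSubmodClosed.Build _ _ L2pred
  L2pred_submod.

Record L2fun := MkL2fun { L2val :> X -> R[i]^o; L2valP : L2val \in L2pred }.

HB.instance Definition _ := [isSub for L2val].
HB.instance Definition _ := [Choice of L2fun by <:].
HB.instance Definition _ := [SubChoice_isSubLmodule of L2fun by <:].

Lemma L2fun_cmeasurable (f : L2fun) : cmeasurable f.
Proof. by have /set_mem[] := L2valP f. Qed.

Lemma L2fun_Lfun (f : L2fun) : @normc R \o f \in Lfun mu 2%:E.
Proof. by have /set_mem[] := L2valP f. Qed.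

Definition L2eq (f g : L2fun) := `[< f = g %[ae mu] >].

Lemma L2eq_refl : reflexive L2eq.
Proof. by move=> f; apply/asboolP; exact: ae_eq_refl. Qed.

Lemma L2eq_sym : symmetric L2eq.
Proof. by move=> f g; apply/idP/idP => /asboolP h; apply/asboolP/ae_eq_sym. Qed.

Lemma L2eq_trans : transitive L2eq.
Proof.
by move=> f g h /asboolP gf /asboolP fh; apply/asboolP/(ae_eq_trans gf fh).
Qed.

Canonical L2eq_equiv := EquivRel L2eq L2eq_refl L2eq_sym L2eq_trans.

Local Open Scope quotient_scope.

Definition L2 : Type := {eq_quot L2eq}.
HB.instance Definition _ := Choice.on L2.
HB.instance Definition _ := EqQuotient.on L2.

Definition L2repr (f : L2) : X -> R[i] := repr f.

Lemma L2_eqP (f g : L2fun) : \pi_L2 f = \pi_L2 g <-> f = g %[ae mu].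
Proof.
by split=> [/eqmodP/asboolP|fg]; last exact/eqmodP/asboolP.
Qed.

Lemma reprL2 (f : L2fun) : repr (\pi_L2 f) = f %[ae mu].
Proof. by apply/L2_eqP; rewrite reprK. Qed.

Definition L2zero : L2 := \pi_L2 0.
Definition L2opp (f : L2) : L2 := \pi_L2 (- repr f).
Definition L2add (f g : L2) : L2 := \pi_L2 (repr f + repr g).
Definition L2scale (a : R[i]) (f : L2) : L2 := \pi_L2 (a *: repr f).

Lemma pi_L2add (f g : L2fun) : L2add (\pi_L2 f) (\pi_L2 g) = \pi_L2 (f + g).
Proof.
apply/L2_eqP; move: (reprL2 f) (reprL2 g).
by apply: filterS2 => x /= /(_ I) fx /(_ I) gx _; congr (_ + _).
Qed.

Lemma pi_L2opp (f : L2fun) : L2opp (\pi_L2 f) = \pi_L2 (- f).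
Proof.
apply/L2_eqP; move: (reprL2 f).
by apply: filterS => x /= /(_ I) fx _; congr (- _).
Qed.

Lemma pi_L2scale a (f : L2fun) : L2scale a (\pi_L2 f) = \pi_L2 (a *: f).
Proof.
apply/L2_eqP; move: (reprL2 f).
by apply: filterS => x /= /(_ I) fx _; congr (_ *: _).
Qed.

Lemma L2addA : associative L2add.
Proof.
elim/quotW=> f; elim/quotW=> g; elim/quotW=> h.
by rewrite (pi_L2add g h) (pi_L2add f g) !(pi_L2add f, pi_L2add _ h) addrA.
Qed.

Lemma L2addC : commutative L2add.
Proof. by move=> f g; rewrite /L2add addrC. Qed.

Lemma L2add0 : left_id L2zero L2add.
Proof. by elim/quotW=> f; rewrite (pi_L2add 0 f) add0r. Qed.

Lemma L2addN : left_inverse L2zero L2opp L2add.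
Proof. by elim/quotW=> f; rewrite (pi_L2opp f) (pi_L2add _ f) addNr. Qed.

HB.instance Definition _ :=
  GRing.isZmodule.Build L2 L2addA L2addC L2add0 L2addN.

Lemma L2scaleA a b (f : L2) : L2scale a (L2scale b f) = L2scale (a * b) f.
Proof. by elim/quotW: f => f; rewrite !(pi_L2scale _ f) (pi_L2scale a) scalerA. Qed.

Lemma L2scale1 : left_id 1 L2scale.
Proof. by elim/quotW=> f; rewrite (pi_L2scale 1 f) scale1r. Qed.

Lemma L2scaleDr : right_distributive L2scale +%R.
Proof.
move=> a; elim/quotW=> f; elim/quotW=> g.
rewrite (pi_L2add f g : _ + _ = _) !(pi_L2scale a) scalerDr.
by rewrite (pi_L2add (a *: f) (a *: g) : _ + _ = _).
Qed.

Lemma L2scaleDl (f : L2) : {morph L2scale^~ f : a b / a + b}.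
Proof.
elim/quotW: f => f a b.
rewrite (pi_L2scale (a + b) f) (pi_L2scale a f) (pi_L2scale b f) scalerDl.
by rewrite (pi_L2add (a *: f) (b *: f) : _ + _ = _).
Qed.

HB.instance Definition _ := GRing.Zmodule_isLmodule.Build R[i] L2
  L2scaleA L2scale1 L2scaleDr L2scaleDl.

(* The L^2-norm, embedded in R[i]. *)
Definition L2norm (f : L2) : R[i] :=
  (fine ('N[mu]_2%:E[EFin \o (@normc R \o L2repr f)]))%:C.

Definition L2fun_norm (f : L2fun) : R :=
  fine ('N[mu]_2%:E[EFin \o (@normc R \o f)]).

Lemma L2fun_normE (f : L2fun) :
  (L2fun_norm f)%:E = ('N[mu]_2%:E[EFin \o (@normc R \o f)])%E.
Proof.
rewrite /L2fun_norm fineK// fin_numElt (lt_le_trans ltNy0) ?Lnorm_ge0//=.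
by have := L2fun_Lfun f; rewrite inE => /andP[_]; rewrite inE.
Qed.

Lemma eq_L2fun_norm (f g : L2fun) : f = g %[ae mu] ->
  L2fun_norm f = L2fun_norm g.
Proof.
move=> fg; rewrite /L2fun_norm unlock.
apply: (congr1 (fun z => fine (z `^ 2^-1)%E)).
have mF (h : L2fun) :
    measurable_fun setT (fun x => `|(normc (h x))%:E| `^ 2)%E.
  apply/measurable_EFinP.
  apply: (@measurableT_comp _ _ _ _ _ _ (fun x : R => x `^ 2)).
    exact: measurable_powR.
  by apply: measurableT_comp => //; exact/cmeasurable_normc/L2fun_cmeasurable.
apply: ae_eq_integral => //; [exact: mF|exact: mF|].
by move: fg; apply: filterS => x /= /(_ I) fx _; rewrite fx.
Qed.

Lemma L2norm_pi (f : L2fun) : L2norm (\pi_L2 f) = (L2fun_norm f)%:C.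
Proof. by congr (_%:C); apply/eq_L2fun_norm/reprL2. Qed.

Lemma ler_L2normD (f g : L2) : L2norm (f + g) <= L2norm f + L2norm g.
Proof.
elim/quotW: f => f; elim/quotW: g => g.
rewrite (pi_L2add f g : _ + _ = _) !L2norm_pi -rmorphD lecR -lee_fin EFinD.
rewrite !L2fun_normE.
have mn (h : L2fun) : measurable_fun setT (@normc R \o h).
  exact/cmeasurable_normc/L2fun_cmeasurable.
have le12 : (1 <= 2%:E :> \bar R)%E by rewrite lee_fin ler1n.
apply: le_trans (eminkowski mu (mn f) (mn g) le12).
apply: le_normc_Lnorm2; first exact: L2fun_cmeasurable.
- exact: measurable_funD.
- by move=> x; exact: normcD_le.
Qed.

Lemma L2normZ (a : R[i]) (f : L2) : L2norm (a *: f) = `|a| * L2norm f.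
Proof.
elim/quotW: f => f.
rewrite (pi_L2scale a f : _ *: _ = _) !L2norm_pi.
rewrite [`|a|](_ : _ = (normc a)%:C); last by case: a.
rewrite -rmorphM; congr (_%:C); rewrite /L2fun_norm.
have [le12 fL] : (1 <= 2%:E :> \bar R)%E /\ @normc R \o f \in Lfun mu 2%:E.
  by split; [rewrite lee_fin ler1n | exact: L2fun_Lfun].
have := LnormZ (Lfun_Sub le12 fL) (normc a).
rewrite ger0_norm ?normc_ge0// => /(congr1 fine).
rewrite fineM//=; last first.
  rewrite fin_numElt (lt_le_trans ltNy0) ?Lnorm_ge0//=.
  by move: fL; rewrite inE => /andP[_]; rewrite inE.
move=> <-; congr fine; apply: eq_Lnorm => x /=; congr (_%:E).
exact: normcM.
Qed.

Lemma L2norm_eq0 (f : L2) : L2norm f = 0 -> f = 0.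
Proof.
elim/quotW: f => f; rewrite L2norm_pi => /complexI n0.
apply/L2_eqP.
have N0 : ('N[mu]_2%:E[EFin \o (@normc R \o f)] = 0)%E.
  by rewrite -L2fun_normE n0.
have mf : measurable_fun setT (EFin \o (@normc R \o f)).
  exact/measurable_EFinP/cmeasurable_normc/L2fun_cmeasurable.
have p0 : (0 < 2%:E :> \bar R)%E by rewrite lte_fin ltr0n.
move: (Lnorm_eq0_eq0 mf p0 N0).
by apply: filterS => x /= /(_ I)[fx] _; exact: eq0_normc.
Qed.

HB.instance Definition _ := Lmodule_isNormed.Build R[i] L2
  ler_L2normD L2normZ L2norm_eq0.

(* The inner product, linear in the first argument. *)
Definition L2dot (f g : L2) : R[i] :=
  (\int[mu]_x complex.Re (L2repr f x * (L2repr g x)^*))%R +i*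
  (\int[mu]_x complex.Im (L2repr f x * (L2repr g x)^*))%R.

Lemma L2dotxx (f : L2) : L2dot f f = L2norm f ^+ 2.
Proof.
rewrite /L2dot /L2norm -rmorphXn/=.
have zz (z : R[i]) : z * z^* = (normc z ^+ 2)%:C.
  rewrite normcE sqr_sqrtr ?addr_ge0 ?sqr_ge0//; case: z => a b /=.
  by congr (_ +i* _); ring.
under eq_Rintegral do rewrite zz.
under [X in _ +i* X]eq_Rintegral do rewrite zz.
rewrite /= Rintegral_cst// mul0r; congr (_ +i* _).
rewrite /Rintegral.
rewrite (_ : (\int[mu]_x _)%E = ((L2fun_norm (repr f)) ^+ 2)%:E)//.
rewrite -powR_mulrn ?fine_ge0 ?Lnorm_ge0// -poweR_EFin L2fun_normE poweR_Lnorm//.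
apply: eq_integral => x _ /=.
by rewrite ger0_norm ?normc_ge0// powR_mulrn ?normc_ge0.
Qed.

(* The inner product of the Hilbert sum; the norm of the product type is the
   equivalent max-norm, so it only serves to define the topology. *)
Definition L2dot2 (f g : L2 * L2) : R[i] := L2dot f.1 g.1 + L2dot f.2 g.2.

End complex_L2_functions.
Arguments L2repr {d X R mu} f.
Arguments L2dot {d X R} mu f g.
Arguments L2dot2 {d X R} mu f g.

(* An operator from a subspace of H to K is identified with its graph, which is
   a subset of H * K; equality of operators thus includes equality of domains. *)
Section operators.
Context (C : numFieldType).
Implicit Types H K L : normedModType C.

Definition dom H K (T : set (H * K)) : set H :=
  [set f | exists g, T (f, g)].

Definition densely_defined H K (T : set (H * K)) := dense (dom T).

Definition ker H K (T : set (H * K)) : set H := [set f | T (f, 0)].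

Definition is_operator H K (T : set (H * K)) :=
  [/\ T 0,
      (forall a p q, T p -> T q -> T (a *: p + q)) &
      (forall f g1 g2, T (f, g1) -> T (f, g2) -> g1 = g2)].

Definition graph H K (u : H -> K) : set (H * K) := [set p | p.2 = u p.1].

Definition opscale H K (a : C) (T : set (H * K)) : set (H * K) :=
  [set p | exists2 g, T (p.1, g) & p.2 = a *: g].

Definition opadd H K (S T : set (H * K)) : set (H * K) :=
  [set p | exists g h, [/\ S (p.1, g), T (p.1, h) & p.2 = g + h]].

(* The product S T, "first T, then S". *)
Definition opcomp H K L (S : set (K * L)) (T : set (H * K)) : set (H * L) :=
  [set p | exists2 g, T (p.1, g) & S (g, p.2)].

Definition column H K L (S : set (H * K)) (T : set (H * L)) :
    set (H * (K * L)) :=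
  [set p | S (p.1, p.2.1) /\ T (p.1, p.2.2)].

(* The adjoint, w.r.t. the inner products of H and K, of a densely defined
   operator. *)
Definition adjoint H K (dotH : H -> H -> C) (dotK : K -> K -> C)
    (T : set (H * K)) : set (K * H) :=
  [set q | forall p, T p -> dotK p.2 q.1 = dotH p.1 q.2].

Definition positive_selfadjoint H (dotH : H -> H -> C) (P : set (H * H)) :=
  [/\ is_operator P, densely_defined P, adjoint dotH dotH P = P &
      forall f g, P (f, g) -> 0 <= dotH g f].

(* P = |T|, the positive self-adjoint square root of T^* T. *)
Definition is_modulus H K (dotH : H -> H -> C) (dotK : K -> K -> C)
    (T : set (H * K)) (P : set (H * H)) :=
  positive_selfadjoint dotH P /\
  opcomp P P = opcomp (adjoint dotH dotK T) T.

(* U is bounded, and isometric on the orthogonal complement of its kernel. *)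
Definition partial_isometry H K (dotH : H -> H -> C) (dotK : K -> K -> C)
    (U : {linear H -> K}) :=
  continuous U /\
  forall f, (forall g, U g = 0 -> dotH f g = 0) -> dotK (U f) (U f) = dotH f f.

(* T = U P is the polar decomposition of T. *)
Definition polar_decomposition H K (dotH : H -> H -> C) (dotK : K -> K -> C)
    (T : set (H * K)) (U : {linear H -> K}) (P : set (H * H)) :=
  [/\ is_modulus dotH dotK T P,
      partial_isometry dotH dotK U,
      ker (graph U) = ker T &
      T = opcomp (graph U) P].

(* lam U P + (1 - lam) P U *)
Definition mean_transform H (lam : C) (U : H -> H) (P : set (H * H)) :
    set (H * H) :=
  opadd (opscale lam (opcomp (graph U) P))
        (opscale (1 - lam) (opcomp P (graph U))).

Definition spherical_mean_transform H (lam : C) (U : H -> H * H)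
    (P : set (H * H)) : set (H * (H * H)) :=
  column (mean_transform lam (fun f => (U f).1) P)
         (mean_transform lam (fun f => (U f).2) P).

End operators.

Section weighted_composition.
Context d (X : measurableType d) (R : realType).
Variable mu : {measure set X -> \bar R}.
Implicit Types (phi : X -> X) (w : X -> R[i]).

Definition weighted_measure w (A : set X) : \bar R :=
  (\int[mu]_(x in A) (normc (w x) ^+ 2)%:E)%E.

Definition wco_symbol phi w :=
  [/\ measurable_fun setT phi, cmeasurable w &
      pushforward (weighted_measure w) phi `<< mu].

(* Membership of g in L2 mu encodes the domain condition on f; under wco_symbol
   the choice of the representative of f does not matter. *)
Definition wco phi w : set (L2 mu * L2 mu) :=
  [set p | L2repr p.2 = (fun x => w x * L2repr p.1 (phi x)) %[ae mu]].

End weighted_composition.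

Arguments wco {d X R} mu phi w.

(* Main.v *)
From HB Require Import structures.
Require Import Defs.
From mathcomp Require Import all_boot all_order all_algebra generic_quotient.
From mathcomp Require Import complex.
From mathcomp Require Import all_classical all_reals all_analysis.
From mathcomp Require Import ring lra measurable_realfun.

Set Implicit Arguments.
Unset Strict Implicit.
Unset Printing Implicit Defensive.

Import Order.TTheory GRing.Theory Num.Theory numFieldNormedType.Exports.
Import Normc.

Local Open Scope classical_set_scope.
Local Open Scope ring_scope.
Local Open Scope complex_scope.

(** Every operator in sight turns into a multiplication by a real function,
    up to composition with a symbol, and a set of pairs [(f, g)] with
    [g = m * f] is closed for every nonnegative measurable [m], bounded or not.

    Let [C] be the operator (or the column) under study, [C = U P] its polar
    decomposition.  Density of the domain makes the image under [phi] of the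
    measure [|w|^2 mu] sigma-finite, so that it has a Radon-Nikodym density [h]
    with respect to [mu], finite everywhere ([composition_density_exists]);
    for a column, the densities add up.  The change of variables it provides
    shows that the multiplication [M_h] is contained in [C^* C = P^2]
    ([wco_mult_sub], [column_mult_sub]).  A positive self-adjoint [P] whose
    square contains [M_h] is the multiplication by [k = sqrt h]
    ([positive_sqrt_mult]): this is the uniqueness of the positive square root,
    proved after multiplying everything by the bounded function [1 / (1 + h)].

    Since [U P = C] composes with [phi], the component [U_i] of the polar factor
    satisfies [U_i (a f) = (a o phi_i) U_i f] for bounded [a], first on the
    range of [P] and on its kernel, then everywhere by continuity
    ([polar_factor_mulL2]).  Truncating [k], this gives
    [U_i P f = (k o phi_i) U_i f] ([polar_factor_mult]).  The [i]-th component
    of the mean transform therefore maps [f] to [m_i U_i f], where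
    [m_i = lam (k o phi_i) + (1 - lam) k].

    What remains is that the natural domain is as large as possible: if all the
    [m_i U_i f] are square integrable, then [f] belongs to the domain of [P] and
    each [U_i f] too.  Both terms of [m_i] are nonnegative, so
    [(k o phi_i) U_i f] and [k U_i f] are square integrable.  As [U] is
    isometric on the range of [P], the norms of the truncations of [k f] are
    bounded by those of the [(k o phi_i) U_i f], hence [k f] is square
    integrable ([mult_modulus_exists]).  Thus the graph of the transform is the
    set of all [(f, (g_i))] with [g_i = m_i U_i f], which is closed
    ([closed_mult]). *)

(** * Square-integrable functions *)

Section complex_facts.
Variable R : realType.
Implicit Types z : R[i].

Lemma normcRM (a : R) z : normc (a%:C * z) = `|a| * normc z.
Proof. by rewrite normcM Defs.normcE/= expr0n/= addr0 sqrtr_sqr. Qed.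

Lemma normc2E z : normc z ^+ 2 = complex.Re z ^+ 2 + complex.Im z ^+ 2.
Proof. by rewrite Defs.normcE sqr_sqrtr// addr_ge0 ?sqr_ge0. Qed.

Lemma gt0_realc z : 0 < z -> exists2 r : R, 0 < r & r%:C = z.
Proof.
case: z => x y; rewrite ltcE/= => /andP[/eqP -> x0].
by exists x.
Qed.

Lemma normc2_eq0 z : normc z ^+ 2 = 0 -> z = 0.
Proof. by move/eqP; rewrite sqrf_eq0 => /eqP; exact: eq0_normc. Qed.

End complex_facts.

Section square_integrable.
Context d (X : measurableType d) (R : realType).
Variable mu : {measure set X -> \bar R}.
Implicit Types F G : X -> R[i].

Definition sqint F :=
  cmeasurable F /\ (\int[mu]_x ((normc (F x)) ^+ 2)%:E < +oo)%E.

Lemma measurable_normc2 F : cmeasurable F ->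
  measurable_fun setT (fun x => ((normc (F x)) ^+ 2)%:E).
Proof.
by move=> mF; apply/measurable_EFinP/measurable_funX/cmeasurable_normc.
Qed.

(** The L^2-norm is defined through real powers of extended reals; this trades
    them once and for all for the integral of a square. *)
Lemma L2predP F : (F : X -> R[i]^o) \in L2pred mu <-> sqint F.
Proof.
have LE : cmeasurable F ->
    ('N[mu]_2%:E[EFin \o (@normc R \o F)] < +oo)%E <->
    (\int[mu]_x ((normc (F x)) ^+ 2)%:E < +oo)%E.
  move=> mF; rewrite unlock.
  rewrite (_ : (\int[mu]_x _)%E = (\int[mu]_x ((normc (F x)) ^+ 2)%:E)%E).
    split; last exact: poweR_lty.
    by rewrite !ltey; apply: contra_neq => ->; rewrite poweRyr// invr_eq0.
  apply: eq_integral => x _ /=.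
  by rewrite ger0_norm ?normc_ge0// powR_mulrn ?normc_ge0.
split.
  move=> /set_mem[mF]; rewrite inE => /andP[_]; rewrite inE => FL.
  by split=> //; apply/LE.
move=> [mF FL]; apply/mem_set; split => //.
rewrite inE; apply/andP; split; rewrite inE/=; first exact: cmeasurable_normc.
exact/LE.
Qed.

(** Total, with the zero class as the value on functions that are not square
    integrable: no proof has to be carried around. *)
Definition mkL2 F : L2 mu :=
  (\pi_(L2 mu) (insubd (0 : L2fun mu) (F : X -> R[i]^o)))%qT.

Lemma mkL2E F : sqint F -> L2repr (mkL2 F) = F %[ae mu].
Proof.
move=> /L2predP FL.
apply: filterS (reprL2 (insubd (0 : L2fun mu) (F : X -> R[i]^o))) => x /= h _.
by rewrite [LHS](h Logic.I) /insubd insubT.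
Qed.

Lemma sqint_repr (f : L2 mu) : sqint (L2repr f).
Proof. by apply/L2predP; exact: (L2valP (repr f)). Qed.

Lemma L2_ext (f g : L2 mu) : L2repr f = L2repr g %[ae mu] -> f = g.
Proof.
by move=> fg; rewrite -[f]reprK -[g]reprK; apply/L2_eqP.
Qed.

Lemma L2reprD (f g : L2 mu) :
  L2repr (f + g) = (fun x => L2repr f x + L2repr g x) %[ae mu].
Proof. exact: reprL2. Qed.

Lemma L2reprZ a (f : L2 mu) :
  L2repr (a *: f) = (fun x => a * L2repr f x) %[ae mu].
Proof. exact: reprL2. Qed.

Lemma L2repr0 : L2repr (0 : L2 mu) = (fun=> 0) %[ae mu].
Proof. exact: reprL2. Qed.

Lemma L2reprN (f : L2 mu) : L2repr (- f) = (fun x => - L2repr f x) %[ae mu].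
Proof. exact: reprL2. Qed.

Lemma L2reprB (f g : L2 mu) :
  L2repr (f - g) = (fun x => L2repr f x - L2repr g x) %[ae mu].
Proof.
move: (L2reprD f (- g)) (L2reprN g); apply: filterS2 => x /= h1 h2 _.
by rewrite h1// h2.
Qed.

End square_integrable.
Arguments mkL2 {d X R} mu F.
Arguments L2_ext {d X R mu f g}.

(** * Multiplication by real functions *)

Section multiplication.
Context d (X : measurableType d) (R : realType).
Variable mu : {measure set X -> \bar R}.
Implicit Types (f g u v : L2 mu) (a b k : X -> R) (F G : X -> R[i]).

Lemma ae_eq_forallP (T : Type) (F G : X -> T) :
  F = G %[ae mu] <-> {ae mu, forall x, F x = G x}.
Proof. by split; apply: filterS => x //; apply. Qed.

Lemma ae_eq_forall (T : Type) (F G : X -> T) :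
  F = G %[ae mu] -> {ae mu, forall x, F x = G x}.
Proof. by move/ae_eq_forallP. Qed.

Lemma cmeasurable_mul a F : measurable_fun setT a -> cmeasurable F ->
  cmeasurable (fun x => (a x)%:C * F x).
Proof.
move=> ma [mr mi]; split.
- rewrite (_ : (fun x => _) = (fun x => a x * complex.Re (F x))).
    exact: measurable_funM.
  by apply/funext => x; case: (F x) => ? ? /=; rewrite mul0r subr0.
- rewrite (_ : (fun x => _) = (fun x => a x * complex.Im (F x))).
    exact: measurable_funM.
  by apply/funext => x; case: (F x) => ? ? /=; rewrite mul0r addr0.
Qed.

Definition mulL2 a f : L2 mu := mkL2 mu (fun x => (a x)%:C * L2repr f x).

Lemma sqint_ae F G : cmeasurable F -> sqint mu G ->
  {ae mu, forall x, normc (F x) <= normc (G x)} -> sqint mu F.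
Proof.
move=> mF [mG GL] FG; split=> //; apply: le_lt_trans GL.
apply: ae_ge0_le_integral => //.
- by move=> x _; rewrite lee_fin sqr_ge0.
- exact: measurable_normc2.
- by move=> x _; rewrite lee_fin sqr_ge0.
- exact: measurable_normc2.
- by apply: filterS FG => x FG _; rewrite lee_fin ler_pXn2r ?nnegrE ?normc_ge0.
Qed.

Lemma sqintZ (c : R) F : sqint mu F -> sqint mu (fun x => c%:C * F x).
Proof.
move=> /L2predP FL; apply/L2predP.
have [_ H] := L2pred_submod mu.
have [L0 _] := L2pred_submod mu.
have := H c%:C _ _ FL L0.
by rewrite addr0.
Qed.

Lemma sqint_mul a f (c : R) : measurable_fun setT a -> (forall x, `|a x| <= c) ->
  sqint mu (fun x => (a x)%:C * L2repr f x).
Proof.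
move=> ma ac; have [mf _] := sqint_repr f.
apply: sqint_ae (sqintZ c (sqint_repr f)) _; first exact: cmeasurable_mul.
apply: aeW => x; rewrite !normcRM ler_wpM2r ?normc_ge0//.
by rewrite (le_trans (ac x))// ler_norm.
Qed.

Definition bmeasurable a := measurable_fun setT a /\ exists c, forall x, `|a x| <= c.

Lemma mulL2E a f : bmeasurable a ->
  L2repr (mulL2 a f) = (fun x => (a x)%:C * L2repr f x) %[ae mu].
Proof. by move=> [ma [c ac]]; apply/mkL2E/(sqint_mul _ ma ac). Qed.

(** The graph of the possibly unbounded multiplication by [a].  It is used in
    place of [mulL2 a], whose value is junk outside the domain. *)
Definition mult a f g := {ae mu, forall x, L2repr g x = (a x)%:C * L2repr f x}.

Lemma mulL2P a f : bmeasurable a -> mult a f (mulL2 a f).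
Proof. by move/(mulL2E f)/ae_eq_forallP. Qed.

Lemma mult_functional a f g g' : mult a f g -> mult a f g' -> g = g'.
Proof.
by move=> h1 h2; apply/L2_ext/ae_eq_forallP; move: h1 h2; apply: filterS2 => x -> ->.
Qed.

Lemma multD a f g u v : mult a f u -> mult a g v -> mult a (f + g) (u + v).
Proof.
move=> h1 h2; have h3 := ae_eq_forall (L2reprD f g); have h4 := ae_eq_forall (L2reprD u v).
rewrite /mult; near=> x.
have -> : L2repr (u + v) x = L2repr u x + L2repr v x by near: x.
have -> : L2repr (f + g) x = L2repr f x + L2repr g x by near: x.
have -> : L2repr u x = (a x)%:C * L2repr f x by near: x.
have -> : L2repr v x = (a x)%:C * L2repr g x by near: x.
by rewrite mulrDr.
Unshelve. all: by end_near. Qed.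

Lemma multDl a b f u v : mult a f u -> mult b f v ->
  mult (fun x => a x + b x) f (u + v).
Proof.
move=> h1 h2; have h4 := ae_eq_forall (L2reprD u v).
rewrite /mult; near=> x.
have -> : L2repr (u + v) x = L2repr u x + L2repr v x by near: x.
have -> : L2repr u x = (a x)%:C * L2repr f x by near: x.
have -> : L2repr v x = (b x)%:C * L2repr f x by near: x.
by rewrite rmorphD mulrDl.
Unshelve. all: by end_near. Qed.

Lemma multM a b f u v : mult b f u -> mult a u v ->
  mult (fun x => a x * b x) f v.
Proof.
by move=> h1 h2; move: h1 h2; apply: filterS2 => x -> ->; rewrite rmorphM mulrA.
Qed.

Lemma multZ a (r : R) f u : mult a f u -> mult a (r%:C *: f) (r%:C *: u).
Proof.
move=> h1; have h2 := ae_eq_forall (L2reprZ r%:C f); have h3 := ae_eq_forall (L2reprZ r%:C u).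
rewrite /mult; near=> x.
have -> : L2repr (r%:C *: u) x = r%:C * L2repr u x by near: x.
have -> : L2repr (r%:C *: f) x = r%:C * L2repr f x by near: x.
have -> : L2repr u x = (a x)%:C * L2repr f x by near: x.
by rewrite mulrCA.
Unshelve. all: by end_near. Qed.

Lemma mult_cst (r : R) f : mult (fun=> r) f (r%:C *: f).
Proof. exact: (ae_eq_forall (L2reprZ r%:C f)). Qed.

Lemma mult_mulL2 a f u : bmeasurable a -> mult a f u -> mulL2 a f = u.
Proof. by move=> ba; apply: mult_functional; exact: mulL2P. Qed.

Lemma mulL2B a f g : bmeasurable a -> mulL2 a (f - g) = mulL2 a f - mulL2 a g.
Proof.
move=> ba; apply: mult_mulL2 => //; apply: multD; first exact: mulL2P.
by have := multZ (-1) (mulL2P g ba); rewrite rmorphN1 !scaleN1r.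
Qed.

Definition sqnorm f : \bar R := (\int[mu]_x ((normc (L2repr f x)) ^+ 2)%:E)%E.

Definition rnorm f : R := L2fun_norm (repr f).

Lemma normE f : `|f| = (rnorm f)%:C.
Proof. by []. Qed.

Lemma rnorm_ge0 f : 0 <= rnorm f.
Proof. by rewrite /rnorm fine_ge0// Lnorm_ge0. Qed.

Lemma sqnormE f : sqnorm f = (rnorm f ^+ 2)%:E.
Proof.
rewrite -powR_mulrn ?rnorm_ge0// -poweR_EFin L2fun_normE poweR_Lnorm//.
apply: eq_integral => x _ /=.
by rewrite ger0_norm ?normc_ge0// powR_mulrn ?normc_ge0.
Qed.

Lemma sqnorm_mulL2_le a f (c : R) : measurable_fun setT a -> (forall x, `|a x| <= c) ->
  (sqnorm (mulL2 a f) <= (c ^+ 2)%:E * sqnorm f)%E.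
Proof.
move=> ma ac; have h := mulL2P f (conj ma (ex_intro _ c ac)).
rewrite /sqnorm -ge0_integralZl//=; last 3 first.
- exact/measurable_normc2/(sqint_repr f).1.
- by move=> x _; rewrite lee_fin sqr_ge0.
- by rewrite lee_fin sqr_ge0.
apply: ae_ge0_le_integral => //.
- by move=> x _; rewrite lee_fin sqr_ge0.
- exact/measurable_normc2/(sqint_repr _).1.
- by move=> x _; rewrite mule_ge0// lee_fin sqr_ge0.
- exact/measurable_funeM/measurable_normc2/(sqint_repr f).1.
apply: filterS h => x hx _; rewrite -EFinM lee_fin hx normcRM exprMn.
rewrite ler_wpM2r ?sqr_ge0// ler_pXn2r ?nnegrE//.
by rewrite (le_trans _ (ac x)).
Qed.

Lemma mulL2_continuous a : bmeasurable a -> continuous (mulL2 a).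
Proof.
move=> ba f; apply/(@cvgrPdist_lt _ (L2 mu) (L2 mu) (nbhs f)) => e e0.
have [ma [c ac]] := ba.
have [e1 e10 ee1] := gt0_realc e0.
have c0 : 0 <= `|c| + 1 by rewrite addr_ge0.
have c1 : 0 < `|c| + 1 by rewrite ltr_wpDl.
near=> g.
rewrite -mulL2B// normE -ee1 ltcR.
have : rnorm (f - g) < e1 / (`|c| + 1).
  rewrite -ltcR -normE; near: g.
  apply: (@cvgr_dist_lt _ _ _ (nbhs f) _ id) => //.
  by rewrite ltcR divr_gt0.
rewrite ltr_pdivlMr// mulrC; apply: le_lt_trans.
rewrite -(@ler_pXn2r _ 2) ?nnegrE ?mulr_ge0 ?rnorm_ge0//.
rewrite exprMn -lee_fin [X in (_ <= X)%E]EFinM -!sqnormE; apply: sqnorm_mulL2_le => // x.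
by rewrite (le_trans (ac x))// (le_trans (ler_norm _))// lerDl.
Unshelve. all: by end_near. Qed.

(** The Hilbert space arguments only need the real inner product, for which
    positivity and symmetry are statements about real numbers. *)
Definition rdot f g : R := complex.Re (L2dot mu f g).

Lemma rdotE f g : rdot f g =
  (\int[mu]_x complex.Re (L2repr f x * (L2repr g x)^*))%R.
Proof. by []. Qed.

Lemma rdotC f g : rdot f g = rdot g f.
Proof.
rewrite /rdot /L2dot/=; apply: eq_Rintegral => x _.
by case: (L2repr f x) (L2repr g x) => a b [c e] /=; ring.
Qed.

Lemma cmeasurable_mul_conj f g : cmeasurable (fun x => L2repr f x * (L2repr g x)^*).
Proof.
have [[mf1 mf2] _] := sqint_repr f; have [[mg1 mg2] _] := sqint_repr g.
split.
- rewrite (_ : (fun x => _) = (fun x => complex.Re (L2repr f x) * complex.Re (L2repr g x)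
   + complex.Im (L2repr f x) * complex.Im (L2repr g x))).
    by apply: measurable_funD; exact: measurable_funM.
  by apply/funext => x; case: (L2repr f x) (L2repr g x) => ? ? [? ?] /=; ring.
- rewrite (_ : (fun x => _) = (fun x => complex.Im (L2repr f x) * complex.Re (L2repr g x)
   - complex.Re (L2repr f x) * complex.Im (L2repr g x))).
    by apply: measurable_funB; exact: measurable_funM.
  by apply/funext => x; case: (L2repr f x) (L2repr g x) => ? ? [? ?] /=; ring.
Qed.

Lemma measurable_rdot f g : measurable_fun setT (fun x =>
  complex.Re (L2repr f x * (L2repr g x)^*)).
Proof. exact: (cmeasurable_mul_conj f g).1. Qed.

Lemma normc2_integrable f : mu.-integrable setT
  (EFin \o (fun x => normc (L2repr f x) ^+ 2)).
Proof.
have [mf fL] := sqint_repr f.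
apply/integrableP; split; first exact: measurable_normc2.
apply: le_lt_trans fL; rewrite le_eqVlt; apply/orP; left; apply/eqP.
by apply: eq_integral => x _ /=; rewrite ger0_norm// sqr_ge0.
Qed.

Lemma integrable_rdot f g : mu.-integrable setT
  (EFin \o (fun x => complex.Re (L2repr f x * (L2repr g x)^*))).
Proof.
apply: (@le_integrable _ _ _ mu _ measurableT _
  (fun x => (normc (L2repr f x) ^+ 2 + normc (L2repr g x) ^+ 2)%:E)).
- exact/measurable_EFinP/measurable_rdot.
- move=> x _ /=; rewrite lee_fin [X in _ <= X]ger0_norm ?addr_ge0 ?sqr_ge0//.
  rewrite !normc2E ler_norml.
  case: (L2repr f x) (L2repr g x) => p q [r s] /=.
  have := (sqr_ge0 (p + r), sqr_ge0 (q + s), sqr_ge0 (p - r), sqr_ge0 (q - s)).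
  have := (sqr_ge0 p, sqr_ge0 q, sqr_ge0 r, sqr_ge0 s).
  by move=> [[[? ?] ?] ?] [[[? ?] ?] ?]; apply/andP; split; nra.
- exact: (integrableD measurableT (normc2_integrable f) (normc2_integrable g)).
Qed.

Lemma eq_ae_Rintegral (a b : X -> R) : measurable_fun setT a ->
  measurable_fun setT b -> {ae mu, forall x, a x = b x} ->
  (\int[mu]_x a x)%R = (\int[mu]_x b x)%R.
Proof.
move=> ma mb ab; rewrite /Rintegral; congr fine.
apply: ae_eq_integral => //; [exact/measurable_EFinP|exact/measurable_EFinP|].
by apply: filterS ab => x -> .
Qed.

Lemma rdotDl f f' g : rdot (f + f') g = rdot f g + rdot f' g.
Proof.
rewrite !rdotE -RintegralD//; [|exact: integrable_rdot..].
apply: eq_ae_Rintegral.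
- exact: measurable_rdot.
- by apply: measurable_funD; exact: measurable_rdot.
- by apply: filterS (ae_eq_forall (L2reprD f f')) => x ->; rewrite mulrDl raddfD.
Qed.

Lemma rdotNl f g : rdot (- f) g = - rdot f g.
Proof.
apply/eqP; rewrite -addr_eq0 -rdotDl addNr rdotE.
rewrite (@eq_ae_Rintegral _ (fun=> 0)).
- by rewrite Rintegral_cst// mul0r.
- exact: measurable_rdot.
- exact: measurable_cst.
- by apply: filterS (ae_eq_forall (L2repr0 mu)) => x ->; rewrite mul0r.
Qed.

Lemma rdotBl f f' g : rdot (f - f') g = rdot f g - rdot f' g.
Proof. by rewrite rdotDl rdotNl. Qed.

Lemma rdotDr f g g' : rdot f (g + g') = rdot f g + rdot f g'.
Proof. by rewrite rdotC rdotDl !(rdotC f). Qed.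

Lemma rdotBr f g g' : rdot f (g - g') = rdot f g - rdot f g'.
Proof. by rewrite rdotC rdotBl !(rdotC f). Qed.

Lemma rdot_self f : rdot f f = rnorm f ^+ 2.
Proof. by rewrite /rdot L2dotxx -[L2norm f]/(rnorm f)%:C -rmorphXn. Qed.

Lemma rdot_self_ge0 f : 0 <= rdot f f.
Proof. by rewrite rdot_self sqr_ge0. Qed.

Lemma rdot_self_eq0 f : rdot f f = 0 -> f = 0.
Proof.
rewrite rdot_self => /eqP; rewrite sqrf_eq0 => /eqP f0.
by apply/normr0_eq0; rewrite normE f0.
Qed.

Lemma rdot_mult a f g u v : mult a f u -> mult a g v -> rdot u g = rdot f v.
Proof.
move=> fu gv; rewrite !rdotE; apply: eq_ae_Rintegral; try exact: measurable_rdot.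
move: fu gv; apply: filterS2 => x -> ->.
by case: (L2repr f x) (L2repr g x) => ? ? [? ?] /=; ring.
Qed.

Lemma dot_mult a f g u v : mult a f u -> mult a g v -> L2dot mu u g = L2dot mu f v.
Proof.
move=> fu gv; rewrite /L2dot; congr (_ +i* _); first exact: rdot_mult fu gv.
apply: eq_ae_Rintegral; try exact: (cmeasurable_mul_conj _ _).2.
move: fu gv; apply: filterS2 => x -> ->.
by case: (L2repr f x) (L2repr g x) => ? ? [? ?] /=; ring.
Qed.

End multiplication.
Arguments mult {d X R} mu a f g.

(** * Limits and algebra of bounded multiplications *)

Section limits.
Context d (X : measurableType d) (R : realType).
Variable mu : {measure set X -> \bar R}.
Implicit Types (f g u v : L2 mu) (a b k : X -> R) (F G : X -> R[i]).

(** Dominated convergence in the form shared by the strong and weak limits of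
    multiplication operators used below. *)
Lemma cvg_Rintegral_mul (c_ : nat -> X -> R) (c G : X -> R) (M : R) :
  (forall n, measurable_fun setT (c_ n)) -> (forall n x, `|c_ n x| <= M) ->
  (forall x, c_ ^~ x @ \oo --> c x) ->
  mu.-integrable setT (EFin \o G) ->
  (\int[mu]_x (c_ n x * G x))%R @[n --> \oo] --> (\int[mu]_x (c x * G x))%R.
Proof.
move=> mc cM cc iG; have /measurable_EFinP mG := measurable_int _ iG.
have mc' : measurable_fun setT c by apply: (measurable_fun_cvg mc) => x _; exact: cc.
have M0 (x : X) : 0 <= M := le_trans (normr_ge0 _) (cM 0%N x).
have H1 : {ae mu, forall x, setT x -> (fun n => (c_ n x * G x)%:E) @ \oo --> (c x * G x)%:E}.
  by apply: aeW => x _; apply: cvg_EFin; [exact: nearW|apply: cvgMl; exact: cc].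
have H2 : mu.-integrable setT (fun x => (M * `|G x|)%:E).
  apply: (integrableZl measurableT M (f := fun x => (`|G x|)%:E)).
  exact: integrable_abse iG.
have H3 : {ae mu, forall x n, setT x -> (`|(c_ n x * G x)%:E| <= (M * `|G x|)%:E)%E}.
  by apply: aeW => x n _ /=; rewrite lee_fin normrM ler_wpM2r.
have mcG n : measurable_fun setT (fun x => (c_ n x * G x)%:E).
  by apply/measurable_EFinP; exact: measurable_funM.
have mcG' : measurable_fun setT (fun x => (c x * G x)%:E).
  by apply/measurable_EFinP; exact: measurable_funM.
have [i1 _ cv] := dominated_convergence measurableT mcG mcG' H1 H2 H3.
apply: fine_cvg => /=; rewrite fineK//.
exact: (integrable_fin_num measurableT i1).
Qed.

(** Bounded pointwise convergence of the multipliers implies strong convergence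
    of the multiplication operators. *)
Lemma closed_mulL2_lim (A : set (L2 mu)) (a_ : nat -> X -> R) (a : X -> R) f (M : R) :
  closed A ->
  (forall n, measurable_fun setT (a_ n)) -> (forall n x, `|a_ n x| <= M) ->
  (forall x, a_ ^~ x @ \oo --> a x) ->
  (forall n, A (mulL2 (a_ n) f)) -> A (mulL2 a f).
Proof.
move=> cA ma aM aa Aa.
have ba n : bmeasurable (a_ n) by split=> //; exists M.
have Ma x : `|a x| <= M.
  have : (fun n => `|a_ n x|) @ \oo --> `|a x| by apply: cvg_norm; exact: aa.
  move=> /cvg_lim <- //; apply: limr_le; last by apply: nearW => n; exact: aM.
  by apply: is_cvg_norm; apply/cvg_ex; exists (a x); exact: aa.
have ba' : bmeasurable a.
  by split; [apply: (measurable_fun_cvg ma) => x _; exact: aa|exists M].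
have lim0 : rnorm (mulL2 a f - mulL2 (a_ n) f) @[n --> \oo] --> (0 : R).
  pose G x := normc (L2repr f x) ^+ 2.
  have nE n : rnorm (mulL2 a f - mulL2 (a_ n) f) =
      Num.sqrt (\int[mu]_x ((a x - a_ n x) ^+ 2 * G x))%R.
    rewrite -[LHS]ger0_norm ?rnorm_ge0// -sqrtr_sqr -rdot_self rdotE; congr Num.sqrt.
    have h1 := ae_eq_forall (L2reprB (mulL2 a f) (mulL2 (a_ n) f)).
    have h2 := mulL2P f ba'; have h3 := mulL2P f (ba n).
    apply: eq_ae_Rintegral.
    - exact: measurable_rdot.
    - apply: measurable_funM.
        by apply: measurable_funX; apply: measurable_funB => //; exact: ba'.1.
      exact/measurable_funX/cmeasurable_normc/(sqint_repr f).1.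
    near=> x.
    have -> : L2repr (mulL2 a f - mulL2 (a_ n) f) x =
      L2repr (mulL2 a f) x - L2repr (mulL2 (a_ n) f) x by near: x.
    have -> : L2repr (mulL2 a f) x = (a x)%:C * L2repr f x by near: x.
    have -> : L2repr (mulL2 (a_ n) f) x = (a_ n x)%:C * L2repr f x by near: x.
    by rewrite /G normc2E; case: (L2repr f x) => p q /=; ring.
  under eq_fun do rewrite nE.
  rewrite -sqrtr0; apply: continuous_cvg; first exact: sqrt_continuous.
  have M0 (x : X) : 0 <= M := le_trans (normr_ge0 _) (aM 0%N x).
  have := @cvg_Rintegral_mul (fun n x => (a x - a_ n x) ^+ 2) (fun=> 0) G ((M + M) ^+ 2).
  under eq_Rintegral do rewrite mul0r.
  rewrite Rintegral_cst// mul0r; apply.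
  - by move=> n; apply: measurable_funX; apply: measurable_funB => //; exact: ba'.1.
  - move=> n x; rewrite normrX ler_pXn2r ?nnegrE ?addr_ge0 ?(M0 x)//.
    by rewrite (le_trans (ler_normB _ _))// lerD.
  - move=> x; rewrite [X in _ --> X](_ : 0 = (a x - a x) * (a x - a x)); last by ring.
    by apply: cvgM; apply: cvgB => //; exact: cvg_cst.
  - exact: normc2_integrable.
apply: (@closed_cvg _ _ \oo _ (fun n => mulL2 (a_ n) f) A) => //.
  exact: nearW.
apply/(@cvgrPdist_lt _ (L2 mu)) => e e0.
have [e1 e10 ee1] := gt0_realc e0.
near=> n; rewrite -ee1 normE ltcR; near: n.
move/cvgrPdist_lt : lim0 => /(_ _ e10); apply: filterS => n.
by rewrite sub0r normrN ger0_norm ?rnorm_ge0.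
Unshelve. all: by end_near. Qed.

End limits.

Section multiplication_algebra.
Context d (X : measurableType d) (R : realType).
Variable mu : {measure set X -> \bar R}.
Implicit Types (f g u v : L2 mu) (a b k : X -> R).

Lemma bmeasD a b : bmeasurable a -> bmeasurable b -> bmeasurable (fun x => a x + b x).
Proof.
move=> [ma [c ac]] [mb [e be]]; split; first exact: measurable_funD.
by exists (c + e) => x; rewrite (le_trans (ler_normD _ _))// lerD.
Qed.

Lemma bmeasM a b : bmeasurable a -> bmeasurable b -> bmeasurable (fun x => a x * b x).
Proof.
move=> [ma [c ac]] [mb [e be]]; split; first exact: measurable_funM.
by exists (c * e) => x; rewrite normrM ler_pM.
Qed.

Lemma bmeas_cst (r : R) : bmeasurable (fun _ : X => r).
Proof. by split; [exact: measurable_cst|exists `|r|]. Qed.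

Lemma mulL2_lin a (r : R) f g : bmeasurable a ->
  mulL2 a (r%:C *: f + g) = r%:C *: mulL2 a f + mulL2 a g.
Proof.
by move=> ba; apply: mult_mulL2 => //; apply: multD; [apply: multZ|]; exact: mulL2P.
Qed.

Lemma mulL2Dl a b f : bmeasurable a -> bmeasurable b ->
  mulL2 (fun x => a x + b x) f = mulL2 a f + mulL2 b f.
Proof.
move=> ba bb; apply: mult_mulL2; first exact: bmeasD.
by apply: multDl; exact: mulL2P.
Qed.

Lemma mulL2M a b f : bmeasurable a -> bmeasurable b ->
  mulL2 (fun x => a x * b x) f = mulL2 a (mulL2 b f).
Proof.
move=> ba bb; apply: mult_mulL2; first exact: bmeasM.
by apply: multM; exact: mulL2P.
Qed.

Lemma mulL2_cst (r : R) f : mulL2 (fun=> r) f = r%:C *: f.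
Proof. by apply: mult_mulL2; [exact: bmeas_cst|exact: mult_cst]. Qed.

Lemma mulL2_0 a : bmeasurable a -> mulL2 a 0 = 0 :> L2 mu.
Proof. by move=> ba; have := mulL2B (0 : L2 mu) 0 ba; rewrite !subrr. Qed.

Lemma rdot_mulL2 a f g : bmeasurable a -> rdot (mulL2 a f) g = rdot f (mulL2 a g).
Proof. by move=> ba; apply: rdot_mult; exact: mulL2P. Qed.

Lemma rdot_mulL2E a f g : bmeasurable a -> rdot (mulL2 a f) g =
  (\int[mu]_x (a x * complex.Re (L2repr f x * (L2repr g x)^*)))%R.
Proof.
move=> ba; rewrite rdotE; apply: eq_ae_Rintegral.
- exact: measurable_rdot.
- by apply: measurable_funM; [exact: ba.1|exact: measurable_rdot].
- apply: filterS (mulL2P f ba) => x ->.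
  by case: (L2repr f x) (L2repr g x) => ? ? [? ?] /=; ring.
Qed.

Lemma rdot_sep f g : (forall v, rdot f v = rdot g v) -> f = g.
Proof.
move=> fg; apply/eqP; rewrite -subr_eq0; apply/eqP/rdot_self_eq0.
by rewrite rdotBl fg subrr.
Qed.

Lemma rdot0r f : rdot f 0 = 0.
Proof. by have := rdotBr f 0 0; rewrite !subrr. Qed.

End multiplication_algebra.

(** * Square roots by polynomial iteration *)

Section sqrt_iteration.
Variable R : realType.

(** The classical iteration converging to the square root of [s ^+ 2] through
    polynomials in [s ^+ 2].  Whatever commutes with
    [s ^+ 2] commutes with the iterates, hence with [s]. *)
Fixpoint sqrt_iter (s : R) n : R :=
  if n is m.+1 then
    sqrt_iter s m + 2^-1 * (s ^+ 2 - sqrt_iter s m ^+ 2) else 0.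

(** The error [s - y_n] is multiplied by [1 - (s + y_n) / 2], which is at most
    [1 - s / 2], at each step. *)
Lemma sqrt_iter_bound (s : R) n : 0 <= s <= 1 ->
  0 <= sqrt_iter s n <= s /\ s - sqrt_iter s n <= s * (1 - s / 2) ^+ n.
Proof.
move=> /andP[s0 s1]; elim: n => [|n [/andP[y0 ys] IH]] /=.
  by rewrite lexx s0 subr0 expr0 mulr1.
move: IH y0 ys; set y := sqrt_iter s n; set z := (1 - s/2) ^+ n => IH y0 ys.
have z0 : 0 <= z by apply: exprn_ge0; nra.
split; first by apply/andP; split; nra.
rewrite [X in _ <= s * X]exprS -/z.
have -> : s - (y + 2^-1 * (s ^+ 2 - y ^+ 2)) = (s - y) * (1 - (s + y) / 2) by field.
have h1 : (s - y) * (1 - (s + y) / 2) <= (s - y) * (1 - s / 2) by nra.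
apply: le_trans h1 _.
rewrite mulrCA [leLHS]mulrC ler_wpM2l//; lra.
Qed.

Lemma sqrt_iter_cvg (s : R) : 0 <= s <= 1 -> sqrt_iter s @ \oo --> s.
Proof.
move=> s01; have /andP[s0 s1] := s01.
have [->|sn0] := eqVneq s 0.
  rewrite (_ : sqrt_iter 0 = fun=> 0); first exact: cvg_cst.
  apply/funext => n; have [] := @sqrt_iter_bound 0 n; first by rewrite lexx ler01.
  by move=> h _; apply/eqP; rewrite eq_le andbC.
have sp : 0 < s by rewrite lt_def sn0.
have g0 : (fun n => s * (1 - s / 2) ^+ n) @ \oo --> (0 : R).
  by apply: cvg_geometric; rewrite ger0_norm; lra.
apply: (@squeeze_cvgr _ _ _ _ (fun n => s - s * (1 - s / 2) ^+ n) (fun=> s)).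
- apply: nearW => n; have [/andP[_ h1] h2] := sqrt_iter_bound n s01.
  by rewrite h1 andbT; lra.
- by rewrite -[X in _ --> X]subr0; apply: cvgB => //; exact: cvg_cst.
- exact: cvg_cst.
Qed.

End sqrt_iteration.

(** * Images of measures with a density *)

Lemma measurable_preimage d1 d2 (X : measurableType d1) (Y : measurableType d2)
    (f : X -> Y) (A : set Y) :
  measurable_fun setT f -> measurable A -> measurable (f @^-1` A).
Proof. by move=> mf mA; rewrite -[_ @^-1` _]setTI; exact: mf. Qed.

Section image_density.
Context d1 d2 (X : measurableType d1) (Y : measurableType d2) (R : realType).
Variable mu : {measure set X -> \bar R}.
Variables (phi : X -> Y) (g : X -> R).
Hypotheses (mphi : measurable_fun setT phi) (mg : measurable_fun setT g).
Hypothesis g0 : forall x, 0 <= g x.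

(** The image under [phi] of the measure with density [g].  The hypotheses are
    arguments so that the measure structure can be attached to the constant. *)
Definition image_density (_ : measurable_fun setT phi) (_ : measurable_fun setT g)
    (_ : forall x, 0 <= g x) (A : set Y) : \bar R :=
  (\int[mu]_(x in phi @^-1` A) (g x)%:E)%E.

Local Notation nu := (image_density mphi mg g0).

Let nu0 : nu set0 = 0%E.
Proof. by rewrite /image_density preimage_set0 integral_set0. Qed.

Let nu_ge0 A : (0 <= nu A)%E.
Proof. by apply: integral_ge0 => x _; rewrite lee_fin. Qed.

Let nu_sigma : semi_sigma_additive nu.
Proof.
move=> F mF tF mUF; rewrite /image_density preimage_bigcup.
apply: (@semi_sigma_additive_nng_induced _ _ _ mu (EFin \o g)).
- exact/measurable_EFinP.
- by move=> x; rewrite lee_fin.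
- by move=> n; exact: measurable_preimage.
- apply/trivIsetP => i j _ _ ij; rewrite -preimage_setI.
  by move/trivIsetP : tF => ->//; rewrite preimage_set0.
- by rewrite -preimage_bigcup; exact: measurable_preimage.
Qed.

HB.instance Definition _ := isMeasure.Build _ _ _ nu nu0 nu_ge0 nu_sigma.

Import HBNNSimple.

(** Change of variables.  With [phi] the identity, this is also the formula for
    integration against a measure with a density. *)
Lemma integral_image_density (G : Y -> \bar R) : measurable_fun setT G ->
  (forall y, (0 <= G y)%E) ->
  (\int[nu]_y G y = \int[mu]_x (G (phi x) * (g x)%:E))%E.
Proof.
move=> mG G0; pose f_ := nnsfun_approx measurableT mG.
have fG y : (f_ n y)%:E @[n --> \oo] --> G y by apply: cvg_nnsfun_approx.
have nd y : {homo (fun n => (f_ n y)%:E) : m n / (m <= n)%N >-> (m <= n)%E}.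
  by move=> m n mn; rewrite lee_fin; exact/lefP/nd_nnsfun_approx.
have mEg : measurable_fun setT (EFin \o g) by exact/measurable_EFinP.
transitivity (limn (fun n => \int[nu]_y (f_ n y)%:E))%E.
  rewrite -monotone_convergence//.
  - by apply: eq_integral => y _; apply/esym/cvg_lim.
  - by move=> n; exact/measurable_EFinP/measurable_funP.
  - by move=> n y _; rewrite lee_fin.
rewrite [X in limn X](_ : _ =
    (fun n => \int[mu]_x ((f_ n (phi x))%:E * (g x)%:E)))%E; last first.
  apply/funext => n.
  transitivity (\int[nu]_y
   (\sum_(k \in range (f_ n)) (k * \1_(f_ n @^-1` [set k]) y)%:E))%E.
    by apply: eq_integral => y _; rewrite /= fimfunE -fsumEFin.
  rewrite ge0_integral_fsum//; last 2 first.
  - by move=> y; apply/measurable_EFinP; exact: measurable_funM.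
  - by move=> k y _; exact: nnfun_muleindic_ge0.
  transitivity (\int[mu]_x (\sum_(k \in range (f_ n))
      (k * \1_(f_ n @^-1` [set k]) (phi x))%:E * (g x)%:E))%E; last first.
    apply: eq_integral => x _.
    rewrite -ge0_mule_fsuml => [|k]; last exact: nnfun_muleindic_ge0.
    by rewrite fsumEFin // -(fimfunE _ (phi x)).
  have m1 k : measurable_fun setT (fun x =>
      (\1_(f_ n @^-1` [set k]) (phi x))%:E : \bar R).
    apply: (@measurableT_comp _ _ _ _ _ _
      (fun y => (\1_(f_ n @^-1` [set k]) y)%:E)) => //.
    exact/measurable_EFinP.
  rewrite ge0_integral_fsum//; last 2 first.
  - move=> k; apply: emeasurable_funM => //.
    under eq_fun do rewrite EFinM.
    exact: measurable_funeM.
  - move=> k x _; rewrite mule_ge0 ?lee_fin//.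
    by rewrite -lee_fin; exact: nnfun_muleindic_ge0.
  apply: eq_fsbigr => k kr.
  rewrite integralZl_indic_nnsfun// integral_indic// setIT.
  under eq_integral do rewrite EFinM -muleA.
  rewrite ge0_integralZl//.
  - congr (_ * _)%E; rewrite /= /image_density.
    rewrite integral_mkcond; apply: eq_integral => x _.
    rewrite patchE indicE.
    have -> : (x \in phi @^-1` (f_ n @^-1` [set k])) =
      (phi x \in f_ n @^-1` [set k]) by apply/idP/idP; rewrite !inE.
    by case: (_ \in _) => /=; rewrite ?mul1e ?mul0e.
  - by apply: emeasurable_funM.
  - by move=> x _; rewrite mule_ge0 ?lee_fin.
  - by move: kr; rewrite inE => -[t _ <-]; rewrite lee_fin.
rewrite -monotone_convergence//.
- by apply: eq_integral => x _; apply/cvg_lim => //; apply: cvgeZr.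
- move=> n; apply: emeasurable_funM => //.
  by apply/measurable_EFinP; apply: (@measurableT_comp _ _ _ _ _ _ (f_ n)).
- by move=> n x _; rewrite mule_ge0 ?lee_fin.
- by move=> x _ m n mn; rewrite lee_wpmul2r ?lee_fin//; exact/lefP/nd_nnsfun_approx.
Qed.

End image_density.

Section image_density_finite.
Context d1 d2 (X : measurableType d1) (Y : measurableType d2) (R : realType).
Variable mu : {measure set X -> \bar R}.
Variables (phi : X -> Y) (g : X -> R).
Hypotheses (mphi : measurable_fun setT phi) (mg : measurable_fun setT g).
Hypothesis g0 : forall x, 0 <= g x.
Hypothesis gfin : (\int[mu]_x (g x)%:E < +oo)%E.

Definition fimage_density (_ : (\int[mu]_x (g x)%:E < +oo)%E) :=
  image_density mu mphi mg g0.

Local Notation nu := (fimage_density gfin).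
HB.instance Definition _ := Measure.on nu.

Let nu_fin : fin_num_fun nu.
Proof.
move=> U mU; rewrite ge0_fin_numE ?measure_ge0//.
apply: le_lt_trans gfin; apply: ge0_subset_integral => //.
- exact: measurable_preimage.
- exact/measurable_EFinP.
- by move=> x _; rewrite lee_fin.
Qed.
HB.instance Definition _ := Measure_isFinite.Build _ _ _ nu nu_fin.

End image_density_finite.

Lemma nneseries_single (R : realType) (a : nat -> \bar R) m :
  (0 <= a m)%E -> (forall n, n != m -> a n = 0%E) -> (\sum_(n <oo) a n = a m)%E.
Proof.
move=> am a0.
have a_ge0 n : (0 <= a n)%E by have [->//|/a0->] := eqVneq n m.
rewrite nneseries_esumT// -[RHS]esum_set1// [RHS]esum_mkcond; apply: eq_esum => n _.
by case: ifPn => // nm; apply: a0; apply: contraNneq nm => ->; exact: mem_set.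
Qed.

(** * The density of a weighted composition *)

(** [h] is the Radon-Nikodym density with respect to [mu] of the image under
    [phi] of the measure of density [|w|^2], stated through integrals because
    this is the only form in which it is used. *)
Definition composition_density d (X : measurableType d) (R : realType)
    (mu : {measure set X -> \bar R}) (phi : X -> X) (w : X -> R[i])
    (h : X -> R) :=
  [/\ measurable_fun setT h, forall x, 0 <= h x &
    forall G : X -> \bar R, measurable_fun setT G -> (forall x, 0 <= G x)%E ->
      (\int[mu]_x (G (phi x) * (normc (w x) ^+ 2)%:E) =
       \int[mu]_x (G x * (h x)%:E))%E].

Section density_on_cover.
Context d (X : measurableType d) (R : realType).
Variable mu : {sigma_finite_measure set X -> \bar R}.
Variables (phi : X -> X) (w : X -> R[i]).
Hypothesis hC : wco_symbol mu phi w.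

Let mphi : measurable_fun setT phi. Proof. by case: hC. Qed.
Let mw : cmeasurable w. Proof. by case: hC. Qed.
Let mw2 : measurable_fun setT (fun x => normc (w x) ^+ 2).
Proof. exact/measurable_funX/cmeasurable_normc. Qed.

Lemma wco_null A : measurable A -> mu A = 0%E ->
  (\int[mu]_(x in phi @^-1` A) (normc (w x) ^+ 2)%:E = 0)%E.
Proof.
have [_ _ /null_content_dominatesP nm] := hC.
by move=> mA A0; exact: nm.
Qed.

(** Absolute continuity for statements that hold almost everywhere: off the
    zeros of [w], a composition with [phi] does not see null sets. *)
Lemma wco_ae (P : X -> Prop) : {ae mu, forall x, P x} ->
  {ae mu, forall x, w x = 0 \/ P (phi x)}.
Proof.
move=> [N [mN N0 PN]].
have := wco_null mN N0.
rewrite (eq_integral (fun x => `|(normc (w x) ^+ 2)%:E|%E)); last first.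
  by move=> x _; rewrite gee0_abs// lee_fin sqr_ge0.
move/ae_eq_integral_abs => /(_ (measurable_preimage mphi mN)) H.
have {}H := H (measurable_funTS (measurable_normc2 mw)).
apply: filterS H => x /= H.
have [Nx|Nx] := pselect (N (phi x)).
  by left; apply: normc2_eq0; have := H Nx => -[].
by right; apply: contrapT => nP; apply: Nx; exact: PN.
Qed.

(** The Radon-Nikodym theorem for finite measures, applied to the pieces of a
    disjoint cover and summed up.  As at most one term of the series is nonzero
    at each point, its sum is finite everywhere. *)
Lemma composition_density_cover (F : nat -> set X) :
  (forall n, measurable (F n)) ->
  (forall n, \int[mu]_(x in phi @^-1` F n) (normc (w x) ^+ 2)%:E < +oo)%E ->
  {ae mu, forall x, exists n, F n x} ->
  exists h, composition_density mu phi w h.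
Proof.
move=> mF Ffin Fcov.
pose E := seqDU F.
have mE n : measurable (E n).
  by apply: measurableD => //; exact: bigsetU_measurable.
have tE := trivIset_seqDU F.
have Euniq n m x : E n x -> E m x -> n = m.
  by move=> En Em; apply: (tE n m) => //; exists x.
pose g n x := normc (w x) ^+ 2 * \1_(E n) (phi x).
have g0 n x : 0 <= g n x by rewrite mulr_ge0// ?sqr_ge0// indicE.
have mg n : measurable_fun setT (g n).
  apply: measurable_funM => //.
  apply: (@measurableT_comp _ _ _ _ _ _ (\1_(E n) : X -> R)) => //.
have gfin n : (\int[mu]_x (g n x)%:E < +oo)%E.
  apply: le_lt_trans (Ffin n).
  rewrite [leRHS]integral_mkcond; apply: ge0_le_integral => //.
  - by move=> x _; rewrite lee_fin.
  - exact/measurable_EFinP.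
  - apply/(measurable_restrictT _ (measurable_preimage mphi (mF n))).1.
    exact/measurable_funTS/measurable_EFinP.
  move=> x _; rewrite patchE /g indicE.
  case: ifPn => xF; first by rewrite lee_fin ler_piMr ?sqr_ge0//; case: (_ \in _).
  rewrite memNset ?mulr0// => -[Fx _].
  by move: xF; rewrite notin_setE; apply.
pose nu n := fimage_density mphi (mg n) (g0 n) (gfin n).
have nu_mu n : nu n `<< mu.
  apply/null_content_dominatesP => A mA A0; apply/eqP.
  rewrite eq_le measure_ge0 andbT -(wco_null mA A0).
  apply: ge0_le_integral => //.
  - exact: measurable_preimage.
  - by move=> x _; rewrite lee_fin.
  - exact/measurable_funTS/measurable_EFinP.
  - exact/measurable_funTS/measurable_EFinP.
  - by move=> x _; rewrite lee_fin ler_piMr ?sqr_ge0// indicE; case: (_ \in _).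
have [f_ /all_and4 [f0 ff fi fE]] :=
  choice (fun n => radon_nikodym_sigma_finite (nu_mu n)).
pose q n x := fine (f_ n x).
have q0 n x : 0 <= q n x by rewrite fine_ge0.
have qE n x : f_ n x = (q n x)%:E by rewrite fineK.
have mq n : measurable_fun setT (q n).
  apply: measurableT_comp => //; exact: (measurable_int _ (fi n)).
have key n (G : X -> \bar R) : measurable_fun setT G -> (forall x, 0 <= G x)%E ->
    (\int[mu]_x (G (phi x) * (g n x)%:E) = \int[mu]_x (G x * (q n x)%:E))%E.
  move=> mG G0; have := integral_image_density mu mphi (mg n) (g0 n) mG G0.
  move=> <-.
  have := integral_image_density mu (@measurable_id _ X setT) (mq n) (q0 n) mG G0.
  move=> /= <-; apply: eq_measure_integral => A mA _.
  by apply: etrans (fE n A mA) _; apply: eq_integral => x _; exact: qE.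
pose h0 x := (\sum_(n <oo) (q n x * \1_(E n) x)%:E)%E.
have h0E m x : E m x -> h0 x = (q m x)%:E.
  move=> Em; rewrite /h0 (@nneseries_single _ _ m).
  - by rewrite indicE mem_set// mulr1.
  - by rewrite lee_fin mulr_ge0// indicE.
  - move=> n nm; rewrite indicE memNset ?mulr0// => En.
    by move/eqP : nm; apply; exact: Euniq En Em.
have h0E' x : (forall n, ~ E n x) -> h0 x = 0%E.
  by move=> nE; apply: eseries0 => n _ _; rewrite indicE memNset ?mulr0.
have h0_ge0 x : (0 <= h0 x)%E.
  by apply: nneseries_ge0 => n _ _; rewrite lee_fin mulr_ge0// indicE.
have mh0 : measurable_fun setT h0.
  apply: ge0_emeasurable_sum => //.
  - by move=> k x _ _; rewrite lee_fin mulr_ge0// indicE.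
  - by move=> k _; apply/measurable_EFinP; exact: measurable_funM.
exists (fine \o h0); split.
- exact: measurableT_comp.
- by move=> x; exact: fine_ge0.
move=> G mG G0.
have mGphi : measurable_fun setT (G \o phi) by exact: measurableT_comp.
transitivity (\int[mu]_x \sum_(n <oo) (G (phi x) * (g n x)%:E))%E.
  apply: ge0_ae_eq_integral => //.
  - by apply: emeasurable_funM => //; exact/measurable_EFinP.
  - apply: ge0_emeasurable_sum => //.
    + by move=> k x _ _; rewrite mule_ge0// lee_fin.
    + by move=> k _; apply: emeasurable_funM => //; exact/measurable_EFinP.
  - by move=> x _; rewrite mule_ge0// lee_fin sqr_ge0.
  - by move=> x _; apply: nneseries_ge0 => n _ _; rewrite mule_ge0// lee_fin.
  apply: filterS (wco_ae Fcov) => x [w0 _|[n Fn] _].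
    rewrite w0 normc0 expr0n/= mule0; apply/esym/eseries0 => n _ _.
    by rewrite /g w0 normc0 expr0n/= mul0r mule0.
  have [m Em] : exists m, E m (phi x).
    have : (\bigcup_n F n) (phi x) by exists n.
    by rewrite (seqDU_bigcup_eq F) => -[m _]; exists m.
  rewrite (@nneseries_single _ _ m).
  - by rewrite /g indicE mem_set// mulr1.
  - by rewrite mule_ge0// lee_fin.
  - move=> k km; rewrite /g indicE memNset ?mulr0 ?mule0// => Ek.
    by move/eqP : km; apply; exact: Euniq Ek Em.
rewrite integral_nneseries//; last 2 first.
- by move=> n; apply: emeasurable_funM => //; exact/measurable_EFinP.
- by move=> n x _; rewrite mule_ge0// lee_fin.
transitivity (\sum_(n <oo) \int[mu]_x (G x * (q n x * \1_(E n) x)%:E))%E.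
  apply: eq_eseriesr => n _.
  transitivity (\int[mu]_x ((G (phi x) * (\1_(E n) (phi x))%:E) * (g n x)%:E))%E.
    apply: eq_integral => x _; rewrite -muleA -EFinM /g.
    by rewrite indicE; case: (_ \in _); rewrite ?mulr1 ?mul1r ?mulr0 ?mul0r.
  rewrite (key n (fun x => G x * (\1_(E n) x)%:E)%E).
  - by apply: eq_integral => x _; rewrite -muleA -EFinM mulrC.
  - by apply: emeasurable_funM => //; exact/measurable_EFinP.
  - by move=> x; rewrite mule_ge0// lee_fin.
rewrite -integral_nneseries//; last 2 first.
- move=> n; apply: emeasurable_funM => //.
  by apply/measurable_EFinP; exact: measurable_funM.
- by move=> n x _; rewrite mule_ge0// lee_fin mulr_ge0.
apply: eq_integral => x _ /=.
have [[m Em]|nE] := pselect (exists m, E m x).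
  rewrite (h0E m)//= (@nneseries_single _ _ m).
  - by rewrite indicE mem_set// mulr1.
  - by rewrite mule_ge0// lee_fin mulr_ge0.
  - move=> k km; rewrite indicE memNset ?mulr0 ?mule0// => Ek.
    by move/eqP : km; apply; exact: Euniq Ek Em.
rewrite h0E' ?mule0; last by move=> n En; apply: nE; exists n.
apply: eseries0 => n _ _; rewrite indicE memNset ?mulr0 ?mule0// => En.
by apply: nE; exists n.
Qed.

End density_on_cover.

Section dense_domain.
Context d (X : measurableType d) (R : realType).
Variable mu : {sigma_finite_measure set X -> \bar R}.

Lemma densely_defined_approx (T : set (L2 mu * L2 mu)) (f : L2 mu) (e : R) :
  densely_defined T -> 0 < e -> exists p, T p /\ rnorm (f - p.1) < e.
Proof.
move=> dT e0; have [||g [+ [k Tgk]]] := dT (ball f e%:C).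
- by exists f; apply: ballxx; rewrite ltcR.
- by apply: ball_open; rewrite ltcR.
rewrite -ball_normE /ball_/= normE ltcR => fg.
by exists (g, k).
Qed.

(** Chebyshev's inequality at level [1/2]. *)
Lemma measure_le_sqnorm (A : set X) (f : L2 mu) : measurable A ->
  {ae mu, forall x, A x -> 1 <= 4 * normc (L2repr f x) ^+ 2} ->
  (mu A <= (4 * rnorm f ^+ 2)%:E)%E.
Proof.
move=> mA Af; rewrite EFinM -sqnormE /sqnorm -ge0_integralZl//; last 2 first.
- exact/measurable_normc2/(sqint_repr f).1.
- by move=> x _; rewrite lee_fin sqr_ge0.
have -> : mu A = (\int[mu]_x (\1_A x)%:E)%E by rewrite integral_indic// setIT.
apply: ae_ge0_le_integral => //.
- exact/measurable_EFinP.
- by move=> x _; rewrite mule_ge0// lee_fin sqr_ge0.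
- exact/measurable_funeM/measurable_normc2/(sqint_repr f).1.
apply: filterS Af => x Af _; rewrite -EFinM lee_fin indicE.
case: (boolP (x \in A)) => [xA|_]; last by rewrite mulr_ge0// sqr_ge0.
by apply: Af; exact: set_mem.
Qed.

Variables (phi : X -> X) (w : X -> R[i]).
Hypothesis hC : wco_symbol mu phi w.
Hypothesis dC : densely_defined (wco mu phi w).

Let mphi : measurable_fun setT phi. Proof. by case: hC. Qed.
Let mw : cmeasurable w. Proof. by case: hC. Qed.

(** Why density of the domain makes the image measure sigma-finite: approximate
    the indicators of an increasing sequence [E n] of sets of finite measure by
    functions [f_ n] of the domain.  The set [F n] where [|f_ n| >= 1/2] has finite
    image measure, because [w * (f_ n o phi)] is square integrable, and misses
    little of [E n], by Chebyshev's inequality. *)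
Lemma wco_cover : exists F : nat -> set X,
  [/\ forall n, measurable (F n),
   forall n, (\int[mu]_(x in phi @^-1` F n) (normc (w x) ^+ 2)%:E < +oo)%E &
   {ae mu, forall x, exists n, F n x}].
Proof.
have /sigma_finiteP[E [UE ndE mE]] := sigma_finiteT mu.
pose e_ n := mkL2 mu (fun x => (\1_(E n) x)%:C).
have eE n : {ae mu, forall x, L2repr (e_ n) x = (\1_(E n) x)%:C}.
  refine (ae_eq_forall (mkL2E _)); split.
    by split => //=; apply: measurable_indic; exact: (mE n).1.
  rewrite (eq_integral (fun x => (\1_(E n) x)%:E)); last first.
    move=> x _; rewrite Defs.normcE/= expr0n/= addr0 sqrtr_sqr.
    by rewrite indicE; case: (_ \in _); rewrite ?normr1 ?normr0 ?expr1n ?expr0n.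
  by rewrite integral_indic//= ?setIT; [exact: (mE n).2|exact: (mE n).1].
have /choice[p_ Hp] n := @densely_defined_approx _ (e_ n) (n.+1%:R^-1) dC
  (ltac:(by rewrite invr_gt0)).
pose f_ n := (p_ n).1.
have mf n : measurable_fun setT (fun x => normc (L2repr (f_ n) x) ^+ 2).
  exact/measurable_funX/cmeasurable_normc/(sqint_repr _).1.
(* 4^-1 is the square of the level 1/2 *)
pose F n := [set x | 4^-1 <= normc (L2repr (f_ n) x) ^+ 2].
have mF n : measurable (F n).
  rewrite /F -[X in measurable X]setTI.
  have := @measurable_fun_le _ _ _ setT (fun=> 4^-1) _ measurableT (measurable_cst _) (mf n).
  by [].
have mpre n : measurable (phi @^-1` F n) by exact: measurable_preimage.
exists F; split => //.
- move=> n.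
  have [Tp _] := Hp n.
  have fin : (sqnorm (p_ n).2 < +oo)%E by have [] := sqint_repr (p_ n).2.
  have : (4%:E * sqnorm (p_ n).2 < +oo)%E by rewrite sqnormE -EFinM ltry.
  apply: le_lt_trans.
  rewrite /sqnorm -ge0_integralZl//; last 2 first.
  + exact/measurable_normc2/(sqint_repr _).1.
  + by move=> x _; rewrite lee_fin sqr_ge0.
  rewrite [leLHS]integral_mkcond; apply: ae_ge0_le_integral => //.
  + by move=> x _; rewrite patchE; case: ifPn => //; rewrite lee_fin sqr_ge0.
  + apply/(measurable_restrictT _ (mpre n)).1/measurable_funTS.
    exact: measurable_normc2.
  + by move=> x _; rewrite mule_ge0// lee_fin sqr_ge0.
  + exact/measurable_funeM/measurable_normc2/(sqint_repr _).1.
  move/ae_eq_forallP : Tp; apply: filterS => x px _; rewrite patchE px.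
  case: ifPn => [|_]; last by rewrite mule_ge0// lee_fin sqr_ge0.
  rewrite inE /F/= => Fx; rewrite -EFinM lee_fin normcM exprMn.
  have := sqr_ge0 (normc (w x)); move: Fx; rewrite /f_.
  set a := _ ^+ 2; set b := _ ^+ 2; nra.
- have mN : measurable (~` \bigcup_n F n).
    by apply: measurableC; exact: bigcup_measurable.
  exists (~` \bigcup_n F n); split => //; last first.
    by move=> x /= nF [n _ Fn]; apply: nF; exists n.
  rewrite -[X in mu X](setIT _) UE setI_bigcupr.
  apply/eqP; rewrite eq_le measure_ge0 andbT.
  have mNE m : measurable ((~` \bigcup_n F n) `&` E m).
    by apply: measurableI => //; exact: (mE m).1.
  rewrite (le_trans (generalized_Boole_inequality _ mNE _))//.
    exact: bigcup_measurable.
  rewrite eseries0// => m _ _; apply/eqP.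
  rewrite eq_le measure_ge0 andbT.
  apply/lee_addgt0Pr => e e0; rewrite add0e.
  near \oo => n.
  have mn : (m <= n)%N by near: n; exact: nbhs_infty_ge.
  have : n.+1%:R^-1 < e / 4.
    by near: n; exact: (near_infty_natSinv_lt (PosNum (divr_gt0 e0 (ltr0n _ 4)))).
  move=> ne.
  have [_ rn] := Hp n.
  apply: (@le_trans _ _ (4 * rnorm (e_ n - f_ n) ^+ 2)%:E); last first.
    rewrite lee_fin.
    have r0 := rnorm_ge0 (e_ n - f_ n).
    have n1 : n.+1%:R^-1 <= 1 :> R by rewrite invf_le1// ler1n.
    have : rnorm (e_ n - f_ n) < e/4 by exact: lt_trans rn ne.
    have : rnorm (e_ n - f_ n) < 1 by exact: lt_le_trans rn n1.
    by rewrite /f_; nra.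
  apply: measure_le_sqnorm; first exact: mNE.
  have := ae_eq_forall (L2reprB (e_ n) (f_ n)).
  move: (eE n); apply: filterS2 => x -> -> [nF Em].
  have En : E n x by have /subsetPset := ndE _ _ mn; apply.
  rewrite indicE mem_set//=.
  have : ~ F n x by move=> Fn; apply: nF; exists n.
  rewrite /F/= => /negP; rewrite -ltNge !normc2E/=.
  by case: (L2repr (f_ n) x) => a b/=; nra.
Unshelve. all: by end_near. Qed.

Theorem composition_density_exists :
  exists h, composition_density mu phi w h.
Proof.
by have [F [mF Ffin Fcov]] := wco_cover; exact: composition_density_cover Fcov.
Qed.

End dense_domain.

Lemma measurable_inv_ge0 d (X : measurableType d) (R : realType) (a : X -> R) :
  measurable_fun setT a -> (forall x, 0 <= a x) ->
  measurable_fun setT (fun x => (a x)^-1).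
Proof.
move=> ma a0; under eq_fun do rewrite -powR_inv1//.
exact: (measurableT_comp (measurable_powR _)).
Qed.

Lemma measurable_sqrt d (X : measurableType d) (R : realType) (a : X -> R) :
  measurable_fun setT a -> measurable_fun setT (fun x => Num.sqrt (a x)).
Proof.
move=> ma; apply: (@measurableT_comp _ _ _ _ _ _ (@Num.sqrt R)) => //.
by apply: continuous_measurable_fun => x; exact: sqrt_continuous.
Qed.

(** * Uniqueness of the positive square root *)

Section square_root.
Context d (X : measurableType d) (R : realType).
Variable mu : {measure set X -> \bar R}.
Variables (P : set (L2 mu * L2 mu)) (h : X -> R).
Hypothesis Pps : positive_selfadjoint (L2dot mu) P.
Hypotheses (mh : measurable_fun setT h) (h0 : forall x, 0 <= h x).
Hypothesis hPP : forall f v, mult mu h f v -> opcomp P P (f, v).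
Implicit Types (f g u v : L2 mu) (a : X -> R).

Let P_lin (r : R) f f' v v' : P (f, v) -> P (f', v') ->
  P (r%:C *: f + f', r%:C *: v + v').
Proof. by case: Pps => -[_ Pl _] _ _ _ H1 H2; exact: (Pl r%:C (f, v) (f', v')). Qed.

Let P_fun f v v' : P (f, v) -> P (f, v') -> v = v'.
Proof. by case: Pps => -[_ _ Pf] _ _ _; exact: Pf. Qed.

Let P_sym f v f' v' : P (f, v) -> P (f', v') -> rdot v f' = rdot f v'.
Proof.
case: Pps => _ _ Pa _ Pf Pf'.
have : adjoint (L2dot mu) (L2dot mu) P (f', v') by rewrite Pa.
by move=> /(_ _ Pf)/= H; rewrite /rdot H.
Qed.

Let P_pos f v : P (f, v) -> 0 <= rdot v f.
Proof.
by case: Pps => _ _ _ Pp /Pp; rewrite /rdot lecE/= => /andP[].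
Qed.

Let P_sub f f' v v' : P (f, v) -> P (f', v') -> P (f - f', v - v').
Proof.
move=> H1 H2; have := P_lin (-1) H2 H1.
by rewrite !rmorphN1 !scaleN1r ![- _ + _]addrC.
Qed.

Let k x := Num.sqrt (h x).
Let b x := (1 + h x)^-1.
Let c x := h x * (1 + h x)^-1.
Let q x := k x * (1 + h x)^-1.

Let mk : measurable_fun setT k.
Proof. exact: measurable_sqrt. Qed.

Let h1 x : 0 < 1 + h x. Proof. by rewrite ltr_wpDr. Qed.

Let mb : measurable_fun setT b.
Proof.
by apply: measurable_inv_ge0 => [|x]; [exact: measurable_funD|exact: ltW].
Qed.

Let b01 x : 0 <= b x <= 1.
Proof. by rewrite /b invr_ge0 ltW//= invf_le1// lerDl. Qed.

Let bb : bmeasurable b.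
Proof.
by split=> //; exists 1 => x; have /andP[b0 b1] := b01 x; rewrite ger0_norm.
Qed.

Let c01 x : 0 <= c x <= 1.
Proof.
apply/andP; split; first by rewrite mulr_ge0// invr_ge0 ltW.
by rewrite /c ler_pdivrMr// mul1r lerDr.
Qed.

Let bc : bmeasurable c.
Proof.
split; first exact: measurable_funM.
by exists 1 => x; have /andP[b0 b1] := c01 x; rewrite ger0_norm.
Qed.

Let k2 x : k x * k x = h x. Proof. by rewrite -expr2 sqr_sqrtr. Qed.
Let k0 x : 0 <= k x. Proof. exact: sqrtr_ge0. Qed.

Let q01 x : 0 <= q x <= 1.
Proof.
apply/andP; split; first by rewrite mulr_ge0// invr_ge0 ltW.
rewrite /q ler_pdivrMr// mul1r -k2.
by have := k0 x; have := sqr_ge0 (k x - 1); nra.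
Qed.

Let bq : bmeasurable q.
Proof.
split; first exact: measurable_funM.
by exists 1 => x; have /andP[b0 b1] := q01 x; rewrite ger0_norm.
Qed.

Local Notation B := (mulL2 b).
Local Notation H := (mulL2 c).

Let BH f : B f + H f = f.
Proof.
rewrite -mulL2Dl// -[RHS]scale1r -[1]/(1%:C) -mulL2_cst; congr (mulL2 _ f).
by apply/funext => x; rewrite /b /c -[X in X + _]mul1r -mulrDl divff// gt_eqF.
Qed.

(** [S = P (1 + P^2)^-1], a bounded operator: since [M_h] is contained in [P^2],
    multiplication by [b = 1 / (1 + h)] is the inverse of [1 + P^2]. *)
Let exS f : exists s, P (B f, s) /\ P (s, H f).
Proof.
have [|s] := hPP (f := B f) (v := H f).
  have := mulL2P f bb; have := mulL2P f bc; rewrite /mult.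
  by apply: filterS2 => x -> ->; rewrite mulrA -rmorphM.
by move=> H1 H2; exists s.
Qed.

Let S f : L2 mu := sval (cid (exS f)).
Let SP f : P (B f, S f). Proof. by rewrite /S; case: cid => s []. Qed.
Let SH f : P (S f, H f). Proof. by rewrite /S; case: cid => s []. Qed.
Let S_eq f s : P (B f, s) -> S f = s. Proof. by move/(P_fun (SP f)). Qed.

Let S_lin (r : R) f g : S (r%:C *: f + g) = r%:C *: S f + S g.
Proof. by apply: S_eq; rewrite mulL2_lin//; exact: P_lin. Qed.

(** [P] is symmetric but [f] and [g] need not be in its domain; splitting one of
    them as [B + H] brings everything into it. *)
Let S_sym f g : rdot (S f) g = rdot f (S g).
Proof.
rewrite -[in LHS](BH g) -[in RHS](BH f) rdotDr rdotDl.
by rewrite -(P_sym (SP f) (SP g)) (P_sym (SH f) (SH g)).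
Qed.

Let S_pos f : 0 <= rdot (S f) f.
Proof.
rewrite -[X in rdot _ X](BH f) rdotDr addr_ge0//; first exact: P_pos.
by rewrite rdotC; exact: P_pos.
Qed.

(** [P] commutes with [(1 + P^2)^-1]: the difference [u] of the two sides is in
    the domain of [P^2] and satisfies [P^2 u = - u], which forces [u = 0]. *)
Let S_comm f v : P (f, v) -> S f = B v.
Proof.
move=> Pfv.
have Hf : P (H f, v - S f).
  have -> : H f = f - B f by rewrite -[X in X - _](BH f) addrC addKr.
  exact: P_sub.
have Hv : H v = v - B v by rewrite -[X in X - _](BH v) addrC addKr.
have := P_sub (SH f) (SP v); set u := S f - B v => U1.
have U2 : P (H f - S v, - u).
  have -> : - u = (v - S f) - (v - B v) by rewrite /u !opprB [RHS]addrC addrA subrK.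
  by rewrite -Hv; exact: P_sub.
have uu : rdot (H f - S v) (H f - S v) = - rdot u u.
  by rewrite (P_sym U1 U2) rdotC rdotNl.
apply/eqP; rewrite -subr_eq0; apply/eqP/rdot_self_eq0/eqP.
by rewrite eq_le rdot_self_ge0 andbT -oppr_ge0 -/u -uu rdot_self_ge0.
Qed.

Let S_S f : S (S f) = mulL2 (fun x => q x * q x) f.
Proof.
rewrite (S_comm (SH f)) -mulL2M//; congr (mulL2 _ f).
by apply/funext => x; rewrite /b /c /q -k2; ring.
Qed.

Let S_add f g : S (f + g) = S f + S g.
Proof. by have := S_lin 1 f g; rewrite !scale1r. Qed.

Let S_scale (r : R) f : S (r%:C *: f) = r%:C *: S f.
Proof.
have S0 : S 0 = 0.
  by have := S_lin 1 0 0; rewrite !scale1r addr0 -[LHS]addr0 => /addrI.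
by have := S_lin r f 0; rewrite !addr0 S0 addr0.
Qed.

(** [S] commutes with [q^2 = S^2], hence with the polynomials in [q^2] and their
    limit [q]. *)
Let comm a := bmeasurable a /\ forall f, S (mulL2 a f) = mulL2 a (S f).

Let comm_add a a' : comm a -> comm a' -> comm (fun x => a x + a' x).
Proof.
move=> [ba ca] [ba' ca']; split; first exact: bmeasD.
by move=> f; rewrite !mulL2Dl// S_add ca ca'.
Qed.

Let comm_mul a a' : comm a -> comm a' -> comm (fun x => a x * a' x).
Proof.
move=> [ba ca] [ba' ca']; split; first exact: bmeasM.
by move=> f; rewrite !mulL2M// ca ca'.
Qed.

Let comm_cst (r : R) : comm (fun=> r).
Proof. by split=> [|f]; [exact: bmeas_cst|rewrite !mulL2_cst S_scale]. Qed.

Let comm_q2 : comm (fun x => q x * q x).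
Proof. by split=> [|f]; [exact: bmeasM|rewrite -!S_S]. Qed.

Let comm_iter n : comm (fun x => sqrt_iter (q x) n).
Proof.
elim: n => [|n IH]; first exact: comm_cst.
have -> : (fun x => sqrt_iter (q x) n.+1) = (fun x => sqrt_iter (q x) n +
    2^-1 * (q x * q x + (-1) * (sqrt_iter (q x) n * sqrt_iter (q x) n))).
  by apply/funext => x /=; ring.
apply: comm_add => //; apply: comm_mul; first exact: comm_cst.
apply: comm_add => //; apply: comm_mul; first exact: comm_cst.
exact: comm_mul.
Qed.

Let S_q f : S (mulL2 q f) = mulL2 q (S f).
Proof.
apply: rdot_sep => g; rewrite S_sym.
pose y n x := sqrt_iter (q x) n.
have lim u v : rdot (mulL2 (y n) u) v @[n --> \oo] --> rdot (mulL2 q u) v.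
  have by_ n : bmeasurable (y n) by have [] := comm_iter n.
  under eq_fun do rewrite rdot_mulL2E//.
  rewrite rdot_mulL2E//.
  apply: (@cvg_Rintegral_mul _ _ _ _ y q _ 1).
  - by move=> n; have [] := by_ n.
  - move=> n x; have [/andP[y0 yq] _] := sqrt_iter_bound n (q01 x).
    rewrite ger0_norm//; apply: le_trans yq _.
    by have /andP[] := q01 x.
  - by move=> x; exact: sqrt_iter_cvg.
  - exact: integrable_rdot.
have := lim f (S g).
under eq_fun => n do rewrite -S_sym (comm_iter n).2.
by move=> /cvg_lim <-//; apply/cvg_lim => //; exact: lim.
Qed.

Let S_sub f g : S (f - g) = S f - S g.
Proof.
by have := S_lin (-1) g f; rewrite !rmorphN1 !scaleN1r ![- _ + _]addrC.
Qed.

(** [S] and the multiplication by [q] are commuting nonnegative operators with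
    the same square.  For [g = S f - q f] one gets [S g + q g = 0], so that
    [<S g, g>] and [<q g, g>], nonnegative with zero sum, vanish; then
    [q g = S g = 0], and [g] is orthogonal to itself. *)
Let S_mul f : S f = mulL2 q f.
Proof.
apply/eqP; rewrite -subr_eq0; apply/eqP; set g := S f - mulL2 q f.
have Sg : S g + mulL2 q g = 0.
  by rewrite /g mulL2B// S_sub S_q S_S mulL2M// addrA subrK subrr.
pose r x := Num.sqrt (q x).
have rE x : r x * r x = q x by rewrite -expr2 sqr_sqrtr//; have /andP[] := q01 x.
have br : bmeasurable r.
  split; first exact: measurable_sqrt bq.1.
  exists 1 => x; rewrite ger0_norm ?sqrtr_ge0// -[leRHS]sqrtr1 ler_sqrt//.
  by have /andP[] := q01 x.
have qr u : mulL2 q u = mulL2 r (mulL2 r u).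
  by rewrite -mulL2M//; congr (mulL2 _ u); apply/funext => x.
have qg0 : rdot (mulL2 q g) g = 0.
  have : rdot (S g) g + rdot (mulL2 q g) g = 0.
    by rewrite -rdotDl Sg rdotC rdot0r.
  have : 0 <= rdot (mulL2 q g) g by rewrite qr rdot_mulL2// rdot_self_ge0.
  by have := S_pos g; lra.
have qg : mulL2 q g = 0.
  move: qg0; rewrite qr rdot_mulL2// => /rdot_self_eq0 ->.
  exact: mulL2_0.
have {}Sg : S g = 0 by move: Sg; rewrite qg addr0.
apply: rdot_self_eq0.
rewrite -[LHS]/(rdot (S f - mulL2 q f) g).
by rewrite rdotBl S_sym Sg rdot_mulL2// qg subrr.
Qed.

(** [P] is contained in the multiplication by [k]; being self-adjoint it cannot
    be smaller than a symmetric extension. *)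
Theorem positive_sqrt_mult f v : P (f, v) <-> mult mu k f v.
Proof.
have Pk f' v' : P (f', v') -> mult mu k f' v'.
  move=> Pfv; have := S_comm Pfv; rewrite S_mul => qb.
  have := mulL2P f' bq; have := mulL2P v' bb; rewrite -qb.
  rewrite /mult; apply: filterS2 => x -> .
  have bx0 : (b x)%:C != 0 by apply/eqP => /(@complexI R _ 0)/eqP; rewrite invr_eq0 gt_eqF.
  rewrite -[q x]/(k x * b x) => e; apply: (mulfI bx0).
  by rewrite e mulrA -rmorphM [b x * k x]mulrC.
split=> [/Pk//|kfv].
case: Pps => _ _ <- _ p /=; case: p => p1 p2 /Pk/= pk.
exact: dot_mult pk kfv.
Qed.

End square_root.

(** * The adjoint of a weighted composition operator *)

Lemma mult_exists d (X : measurableType d) (R : realType)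
    (mu : {measure set X -> \bar R}) (a : X -> R) (f g : L2 mu) :
  measurable_fun setT a ->
  {ae mu, forall x, normc ((a x)%:C * L2repr f x) <= normc (L2repr g x)} ->
  exists u, mult mu a f u.
Proof.
move=> ma ag; exists (mulL2 a f); apply/ae_eq_forallP/mkL2E.
apply: sqint_ae (sqint_repr g) ag; apply: cmeasurable_mul => //.
exact: (sqint_repr f).1.
Qed.

Section weighted_composition_adjoint.
Context d (X : measurableType d) (R : realType).
Variable mu : {sigma_finite_measure set X -> \bar R}.
Variables (phi : X -> X) (w : X -> R[i]) (h : X -> R).
Hypothesis hC : wco_symbol mu phi w.
Hypothesis dh : composition_density mu phi w h.

Let mh : measurable_fun setT h. Proof. by case: dh. Qed.
Let h0 x : 0 <= h x. Proof. by case: dh. Qed.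
Let hE (G : X -> \bar R) : measurable_fun setT G -> (forall x, 0 <= G x)%E ->
  (\int[mu]_x (G (phi x) * (normc (w x) ^+ 2)%:E) =
   \int[mu]_x (G x * (h x)%:E))%E.
Proof. by case: dh => _ _; exact. Qed.
Let mphi : measurable_fun setT phi. Proof. by case: hC. Qed.
Let mw : cmeasurable w. Proof. by case: hC. Qed.
Let mw2 : measurable_fun setT (fun x => normc (w x) ^+ 2).
Proof. exact/measurable_funX/cmeasurable_normc. Qed.

(** Integrability is not required: the change of variables holds separately for
    the positive and negative parts. *)
Lemma Rintegral_composition (G : X -> R) : measurable_fun setT G ->
  (\int[mu]_x (G (phi x) * normc (w x) ^+ 2) = \int[mu]_x (G x * h x))%R.
Proof.
move=> mG; rewrite /Rintegral; congr fine.
have mE (t : R) (c : R) : 0 <= c -> maxe (t * c)%:E 0 = (maxe t%:E 0 * c%:E)%E.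
  by move=> c0; rewrite -!EFin_max -EFinM maxr_pMl// mul0r.
rewrite integralE [RHS]integralE; congr (_ - _)%E.
- have mp : measurable_fun setT (fun x => maxe (G x)%:E 0).
    by apply: measurable_maxe => //; exact/measurable_EFinP.
  transitivity (\int[mu]_x (maxe (G (phi x))%:E 0 * (normc (w x) ^+ 2)%:E))%E.
    by apply: eq_integral => x _; rewrite funeposE mE// sqr_ge0.
  rewrite (hE mp) => [|x]; last by rewrite le_max lexx orbT.
  by apply: eq_integral => x _; rewrite funeposE mE.
- have mp : measurable_fun setT (fun x => maxe (- G x)%:E 0).
    by apply: measurable_maxe => //; apply/measurable_EFinP; exact: measurableT_comp.
  transitivity (\int[mu]_x (maxe (- G (phi x))%:E 0 * (normc (w x) ^+ 2)%:E))%E.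
    by apply: eq_integral => x _; rewrite funenegE -EFinN -mulNr mE// sqr_ge0.
  rewrite (hE mp) => [|x]; last by rewrite le_max lexx orbT.
  by apply: eq_integral => x _; rewrite funenegE -EFinN -mulNr mE.
Qed.

Lemma cmeasurable_wcomp F : cmeasurable F -> cmeasurable (fun x => w x * F (phi x)).
Proof.
move=> [mr mi]; have [wr wi] := mw.
have mr' : measurable_fun setT (fun x => complex.Re (F (phi x))).
  exact: (measurableT_comp mr mphi).
have mi' : measurable_fun setT (fun x => complex.Im (F (phi x))).
  exact: (measurableT_comp mi mphi).
split.
- rewrite (_ : (fun x => _) = (fun x => complex.Re (w x) * complex.Re (F (phi x))
    - complex.Im (w x) * complex.Im (F (phi x)))).
    by apply: measurable_funB; exact: measurable_funM.
  by apply/funext => x; case: (w x) (F (phi x)) => ? ? [].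
- rewrite (_ : (fun x => _) = (fun x => complex.Re (w x) * complex.Im (F (phi x))
    + complex.Im (w x) * complex.Re (F (phi x)))).
    by apply: measurable_funD; exact: measurable_funM.
  by apply/funext => x; case: (w x) (F (phi x)) => ? ? [].
Qed.

(** [h |f|^2 <= |f|^2 + |h f|^2], so the domain of [M_h] is contained in the one of the
    weighted composition operator. *)
Lemma wco_exists f v : mult mu h f v -> exists g, wco mu phi w (f, g).
Proof.
move=> hfv; exists (mkL2 mu (fun x => w x * L2repr f (phi x))).
apply: mkL2E; split; first exact: cmeasurable_wcomp (sqint_repr f).1.
have [mf fL] := sqint_repr f; have [mv vL] := sqint_repr v.
rewrite (eq_integral (fun x => (normc (L2repr f (phi x)) ^+ 2)%:E * (normc (w x) ^+ 2)%:E)%E); last first.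
  by move=> x _; rewrite normcM exprMn EFinM muleC.
rewrite (hE (measurable_normc2 mf)) => [|x]; last by rewrite lee_fin sqr_ge0.
have : (sqnorm f + sqnorm v < +oo)%E by rewrite !sqnormE -EFinD ltry.
apply: le_lt_trans; rewrite /sqnorm -ge0_integralD//; last 4 first.
- by move=> x _; rewrite lee_fin sqr_ge0.
- exact: measurable_normc2.
- by move=> x _; rewrite lee_fin sqr_ge0.
- exact: measurable_normc2.
apply: ae_ge0_le_integral => //.
- by move=> x _; rewrite mule_ge0// lee_fin ?sqr_ge0.
- by apply: emeasurable_funM; [exact: measurable_normc2|exact/measurable_EFinP].
- by move=> x _; rewrite adde_ge0// lee_fin ?sqr_ge0.
- by apply: emeasurable_funD; exact: measurable_normc2.
apply: filterS hfv => x -> _; rewrite -EFinM -EFinD lee_fin normcRM exprMn.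
rewrite real_normK ?num_real//.
by have := sqr_ge0 (normc (L2repr f x)); have := h0 x; nra.
Qed.

Lemma wco_adjoint f g v : wco mu phi w (f, g) -> mult mu h f v ->
  adjoint (L2dot mu) (L2dot mu) (wco mu phi w) (g, v).
Proof.
move=> /ae_eq_forallP/= Cg hfv [f' g'] /ae_eq_forallP/= Cg'; rewrite /L2dot.
have [mr mi] := cmeasurable_mul_conj f' f.
congr (_ +i* _).
- transitivity (\int[mu]_x (complex.Re (L2repr f' (phi x) * (L2repr f (phi x))^*)
    * normc (w x) ^+ 2))%R.
    apply: eq_ae_Rintegral.
    + exact: (cmeasurable_mul_conj _ _).1.
    + by apply: measurable_funM => //; exact: (measurableT_comp mr mphi).
    + move: Cg Cg'; apply: filterS2 => x -> ->; rewrite normc2E.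
      by case: (L2repr f' (phi x)) (L2repr f (phi x)) (w x) => ? ? [? ?] [? ?]/=; ring.
  rewrite (Rintegral_composition mr); apply: eq_ae_Rintegral.
  + exact: measurable_funM.
  + exact: (cmeasurable_mul_conj _ _).1.
  + apply: filterS hfv => x ->.
    by case: (L2repr f' x) (L2repr f x) => ? ? [? ?]/=; ring.
- transitivity (\int[mu]_x (complex.Im (L2repr f' (phi x) * (L2repr f (phi x))^*)
    * normc (w x) ^+ 2))%R.
    apply: eq_ae_Rintegral.
    + exact: (cmeasurable_mul_conj _ _).2.
    + by apply: measurable_funM => //; exact: (measurableT_comp mi mphi).
    + move: Cg Cg'; apply: filterS2 => x -> ->; rewrite normc2E.
      by case: (L2repr f' (phi x)) (L2repr f (phi x)) (w x) => ? ? [? ?] [? ?]/=; ring.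
  rewrite (Rintegral_composition mi); apply: eq_ae_Rintegral.
  + exact: measurable_funM.
  + exact: (cmeasurable_mul_conj _ _).2.
  + apply: filterS hfv => x ->.
    by case: (L2repr f' x) (L2repr f x) => ? ? [? ?]/=; ring.
Qed.

Lemma wco_mult_sub f v : mult mu h f v ->
  opcomp (adjoint (L2dot mu) (L2dot mu) (wco mu phi w)) (wco mu phi w) (f, v).
Proof.
move=> hfv; have [g Cg] := wco_exists hfv.
by exists g => //; exact: wco_adjoint hfv.
Qed.

(** The commutation relation that the polar factor will inherit. *)
Lemma wco_mulL2 (a : X -> R) f g : bmeasurable a -> wco mu phi w (f, g) ->
  wco mu phi w (mulL2 a f, mulL2 (a \o phi) g).
Proof.
move=> ba /ae_eq_forallP/= Cg; apply/ae_eq_forallP => /=.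
have bap : bmeasurable (a \o phi).
  split; first exact: (measurableT_comp ba.1 mphi).
  by have [_ [c ac]] := ba; exists c => x; exact: ac.
have := wco_ae hC (mulL2P f ba).
move: Cg (mulL2P g bap); apply: filterS3 => x Cg -> /=.
by rewrite Cg => -[-> |->]; rewrite ?mul0r ?mulr0// mulrCA.
Qed.

End weighted_composition_adjoint.

(** The imaginary part is a real part, up to multiplication by [- 'i]: the
    algebra of the inner product reduces to the one of [rdot]. *)
Lemma L2dotE d (X : measurableType d) (R : realType)
    (mu : {measure set X -> \bar R}) (f g : L2 mu) :
  L2dot mu f g = rdot f g +i* rdot ('i *: (- f)) g.
Proof.
rewrite /L2dot; congr (_ +i* _); apply: eq_ae_Rintegral.
- exact: (cmeasurable_mul_conj _ _).2.
- exact: (cmeasurable_mul_conj _ _).1.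
- move: (ae_eq_forall (L2reprZ 'i (- f))) (ae_eq_forall (L2reprN f)).
  apply: filterS2 => x -> ->.
  by case: (L2repr f x) (L2repr g x) => ? ? [? ?]/=; ring.
Qed.

Lemma L2dotDr d (X : measurableType d) (R : realType)
    (mu : {measure set X -> \bar R}) (f g g' : L2 mu) :
  L2dot mu f (g + g') = L2dot mu f g + L2dot mu f g'.
Proof. by rewrite !L2dotE !rdotDr. Qed.

Section column_adjoint.
Context d (X : measurableType d) (R : realType).
Variable mu : {sigma_finite_measure set X -> \bar R}.
Variables (phi1 phi2 : X -> X) (w1 w2 : X -> R[i]) (h1 h2 : X -> R).
Hypotheses (hC1 : wco_symbol mu phi1 w1) (hC2 : wco_symbol mu phi2 w2).
Hypotheses (dh1 : composition_density mu phi1 w1 h1).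
Hypotheses (dh2 : composition_density mu phi2 w2 h2).

Lemma column_mult_sub f v : mult mu (fun x => h1 x + h2 x) f v ->
  opcomp (adjoint (L2dot mu) (L2dot2 mu) (column (wco mu phi1 w1) (wco mu phi2 w2)))
    (column (wco mu phi1 w1) (wco mu phi2 w2)) (f, v).
Proof.
have [mh1 h10 _] := dh1; have [mh2 h20 _] := dh2 => hfv.
(* h1 and h2 are at most h1 + h2, so v splits along the two densities *)
have [v1 hv1] : exists v1, mult mu h1 f v1.
  apply: (@mult_exists _ _ _ _ _ _ v) => //; apply: filterS hfv => x ->.
  rewrite !normcRM ler_wpM2r ?normc_ge0// !ger0_norm ?addr_ge0//.
  by rewrite lerDl.
have [v2 hv2] : exists v2, mult mu h2 f v2.
  apply: (@mult_exists _ _ _ _ _ _ v) => //; apply: filterS hfv => x ->.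
  rewrite !normcRM ler_wpM2r ?normc_ge0// !ger0_norm ?addr_ge0//.
  by rewrite lerDr.
have -> : v = v1 + v2 by apply: mult_functional hfv _; exact: multDl.
have [g1 C1] := wco_exists hC1 dh1 hv1.
have [g2 C2] := wco_exists hC2 dh2 hv2.
exists (g1, g2) => // -[f' [g1' g2']] [/= C1' C2'].
rewrite L2dotDr; congr (_ + _).
- exact: (wco_adjoint hC1 dh1 C1 hv1 C1').
- exact: (wco_adjoint hC2 dh2 C2 hv2 C2').
Qed.

End column_adjoint.

(** * Truncations, and closedness of multiplications *)

Section truncations.
Context d (X : measurableType d) (R : realType).
Variable k : X -> R.
Hypotheses (mk : measurable_fun setT k) (k0 : forall x, 0 <= k x).

Definition below n x : R := if k x <= n%:R then 1 else 0.
Definition above n x : R := if n.+1%:R^-1 <= k x then 1 else 0.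

Lemma bmeas_if (b : X -> bool) (a : X -> R) (c : R) :
  measurable_fun setT b -> measurable_fun setT a ->
  (forall x, b x -> `|a x| <= c) -> bmeasurable (fun x => if b x then a x else 0).
Proof.
move=> mb ma ac; split.
  by apply: measurable_fun_ifT => //; exact: measurable_cst.
exists `|c| => x; case: ifPn => [/ac h|_]; last by rewrite normr0.
exact: le_trans h (ler_norm _).
Qed.

Lemma bmeas_below n : bmeasurable (below n).
Proof.
apply: (@bmeas_if _ (fun=> 1) 1) => [||x _]; rewrite ?normr1//.
exact: measurable_fun_ler.
Qed.

Lemma bmeas_below_mul n : bmeasurable (fun x => below n x * k x).
Proof.
rewrite (_ : (fun x => _) = fun x => if k x <= n%:R then k x else 0).
  apply: (@bmeas_if _ k n%:R) => [||x kx] //; last by rewrite ger0_norm.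
  exact: measurable_fun_ler.
by apply/funext => x; rewrite /below; case: ifP; rewrite ?mul1r ?mul0r.
Qed.

Lemma bmeas_above_div n : bmeasurable (fun x => above n x / k x).
Proof.
rewrite (_ : (fun x => _) = fun x => if n.+1%:R^-1 <= k x then (k x)^-1 else 0).
  apply: (@bmeas_if _ (fun x => (k x)^-1) n.+1%:R) => [||x kx].
  - exact: measurable_fun_ler.
  - exact: measurable_inv_ge0.
  - have kp : 0 < k x by apply: lt_le_trans kx; rewrite invr_gt0.
    by rewrite ger0_norm ?invr_ge0// -[leRHS]invrK lef_pV2// posrE invr_gt0.
by apply/funext => x; rewrite /above; case: ifP; rewrite ?mul1r ?mul0r.
Qed.

Lemma below_eq1 x : exists n, below n x = 1.
Proof.
exists (Num.truncn (k x)).+1; rewrite /below ifT// ltW//.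
by apply: Num.Theory.real_truncnS_gt; exact: num_real.
Qed.

Lemma above_near1 x : k x != 0 -> \forall n \near \oo, above n x = 1.
Proof.
move=> kx; have kp : 0 < k x by rewrite lt_def kx k0.
near=> n; rewrite /above ifT// ltW//; near: n.
exact: (near_infty_natSinv_lt (PosNum kp)).
Unshelve. all: by end_near. Qed.

End truncations.

Lemma closed_equalizer (C : numFieldType) (T : topologicalType)
    (V : normedModType C) (F G : T -> V) :
  continuous F -> continuous G -> closed [set x | F x = G x].
Proof.
move=> cF cG.
rewrite (_ : [set x | _] = (fun x => F x - G x) @^-1` [set 0]).
  apply: closed_comp => [x _|]; first by apply: cvgB; [exact: cF|exact: cG].
  apply: accessible_closed_set1; apply: hausdorff_accessible.
  exact: norm_hausdorff.
apply/seteqP; split=> x /=; first by move=> ->; rewrite subrr.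
by move=> /eqP; rewrite subr_eq0 => /eqP.
Qed.

Section closed_multiplication.
Context d (X : measurableType d) (R : realType).
Variable mu : {measure set X -> \bar R}.

(** An unbounded multiplication is described by its bounded truncations, which
    is what makes its graph closed. *)
Lemma mult_below (m : X -> R) (f g : L2 mu) : measurable_fun setT m ->
  (forall x, 0 <= m x) ->
  mult mu m f g <->
  forall n, mulL2 (below m n) g = mulL2 (fun x => below m n x * m x) f.
Proof.
move=> mm m0; split=> [mfg n|H].
  apply: mult_mulL2; first exact: bmeas_below.
  have := mulL2P f (bmeas_below_mul mm m0 n); move: mfg; rewrite /mult.
  by apply: filterS2 => x -> ->; rewrite rmorphM mulrA.
have H' n : {ae mu, forall x, (below m n x)%:C * L2repr g x =
   (below m n x * m x)%:C * L2repr f x}.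
  have := mulL2P g (bmeas_below mm n).
  have := mulL2P f (bmeas_below_mul mm m0 n); rewrite -H.
  by rewrite /mult; apply: filterS2 => x -> .
have /ae_foralln := H'; apply: filterS => x Hx.
have [n mn] := below_eq1 m x.
by have := Hx n; rewrite mn !mul1r.
Qed.

Lemma closed_mult (T : topologicalType) (m : X -> R) (F G : T -> L2 mu) :
  measurable_fun setT m -> (forall x, 0 <= m x) ->
  continuous F -> continuous G -> closed [set p | mult mu m (F p) (G p)].
Proof.
move=> mm m0 cF cG.
rewrite (_ : [set p | _] = \bigcap_n [set p |
   mulL2 (below m n) (G p) = mulL2 (fun x => below m n x * m x) (F p)]).
  apply: closed_bigI => n _.
  apply: (@closed_equalizer _ _ (L2 mu) (fun p => mulL2 (below m n) (G p))) => p.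
    apply: (@continuous_comp _ _ _ G (mulL2 (below m n))); first exact: cG.
    exact/mulL2_continuous/bmeas_below.
  apply: (@continuous_comp _ _ _ F (mulL2 (fun x => below m n x * m x))).
    exact: cF.
  exact/mulL2_continuous/bmeas_below_mul.
apply/seteqP; split=> p /=.
  by move=> /(mult_below _ _ mm m0) H n _ /=.
by move=> H; apply/(mult_below _ _ mm m0) => n; exact: H.
Qed.

End closed_multiplication.

(** * The polar factor *)

Section polar_factor.
Context d (X : measurableType d) (R : realType).
Variable mu : {sigma_finite_measure set X -> \bar R}.
Variables (phi : X -> X) (w : X -> R[i]) (k : X -> R) (U : L2 mu -> L2 mu).
Hypothesis hC : wco_symbol mu phi w.
Hypotheses (mk : measurable_fun setT k) (k0 : forall x, 0 <= k x).
Hypothesis UD : forall f g, U (f + g) = U f + U g.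
Hypothesis cU : continuous U.
(* U is a component of the polar factor of an operator of modulus M_k, one of
   whose components is the weighted composition operator. *)
Hypothesis UC : forall f v, mult mu k f v -> wco mu phi w (f, U v).
Hypothesis U0 : forall f, mult mu k f 0 -> U f = 0.

Let mphi : measurable_fun setT phi. Proof. by case: hC. Qed.

Let bmeas_phi (a : X -> R) : bmeasurable a -> bmeasurable (a \o phi).
Proof.
move=> [ma [c ac]]; split; first exact: (measurableT_comp ma mphi).
by exists c => x; exact: ac.
Qed.

Let wco_inj f g g' : wco mu phi w (f, g) -> wco mu phi w (f, g') -> g = g'.
Proof.
move=> /ae_eq_forallP H1 /ae_eq_forallP H2; apply/L2_ext/ae_eq_forallP.
by move: H1 H2; apply: filterS2 => x /= -> ->.
Qed.

(** The relation is closed and additive in [f].  It holds on the kernel of [M_k],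
    where both sides vanish, and on the functions [k * v], where it is the
    commutation relation of the weighted composition operator.  Every [f] is a
    limit of sums of such functions: cut it at the level sets of [k]. *)
Theorem polar_factor_mulL2 (a : X -> R) f : bmeasurable a ->
  U (mulL2 a f) = mulL2 (a \o phi) (U f).
Proof.
move=> ba; have bap := bmeas_phi ba.
pose e0 x : R := if k x == 0 then 1 else 0.
(* c n is the indicator of {k = 0} or {k >= 1 / (n + 1)}; it tends to 1 *)
pose c n x : R := e0 x + above k n x.
have be0 : bmeasurable e0.
  apply: (@bmeas_if _ _ _ (fun x => k x == 0) (fun=> 1) 1) => [||x _]; rewrite ?normr1//.
  exact: measurable_fun_eqr.
have ba_ n : bmeasurable (above k n).
  apply: (@bmeas_if _ _ _ _ (fun=> 1) 1) => [||x _]; rewrite ?normr1//.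
  exact: measurable_fun_ler.
pose A := [set f | U (mulL2 a f) = mulL2 (a \o phi) (U f)].
have cA : closed A.
  apply: (@closed_equalizer _ _ (L2 mu)) => p.
    by apply: (@continuous_comp _ _ _ (mulL2 a) U);
      [exact: mulL2_continuous|exact: cU].
  by apply: (@continuous_comp _ _ _ U (mulL2 (a \o phi)));
    [exact: cU|exact: mulL2_continuous].
have AD u v : A u -> A v -> A (u + v).
  rewrite /A/= => Au Av.
  have mD b (g g' : L2 mu) : bmeasurable b -> mulL2 b (g + g') = mulL2 b g + mulL2 b g'.
    by move=> bb; apply: mult_mulL2 => //; apply: multD; exact: mulL2P.
  by rewrite mD// !UD Au Av mD.
have A_e0 : A (mulL2 e0 f).
  have kz b : bmeasurable b -> mult mu k (mulL2 b (mulL2 e0 f)) 0.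
    move=> bb; have := mulL2P (mulL2 e0 f) bb; have := mulL2P f be0.
    have := ae_eq_forall (L2repr0 mu); rewrite /mult.
    apply: filterS3 => x -> -> ->; rewrite mulrA mulrA -!rmorphM /e0.
    by case: eqP => [->|_]; rewrite ?mul0r ?mulr0 ?mul0r.
  rewrite /A/= U0; last exact: kz.
  rewrite U0 ?mulL2_0//.
  have := kz _ (bmeas_cst X 1); rewrite mulL2_cst scale1r; exact.
have A_above n : A (mulL2 (above k n) f).
  pose v := mulL2 (fun x => above k n x / k x) f.
  have kv : mult mu k v (mulL2 (above k n) f).
    have := mulL2P f (bmeas_above_div mk k0 n); have := mulL2P f (ba_ n).
    rewrite /mult; apply: filterS2 => x -> ->.
    rewrite mulrA -rmorphM; congr (_%:C * _).
    rewrite /above; case: ifPn => [kx|_]; last by rewrite mul0r mulr0.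
    by rewrite mul1r divff// gt_eqF// (lt_le_trans _ kx)// invr_gt0.
  have kav : mult mu k (mulL2 a v) (mulL2 a (mulL2 (above k n) f)).
    have := mulL2P v ba; have := mulL2P (mulL2 (above k n) f) ba; move: kv.
    by rewrite /mult; apply: filterS3 => x -> -> ->; rewrite mulrCA.
  rewrite /A/=; apply: wco_inj (UC kav) _.
  exact: (wco_mulL2 hC ba (UC kv)).
have -> : f = mulL2 (fun=> 1) f by rewrite mulL2_cst scale1r.
apply: (@closed_mulL2_lim _ _ _ _ A c (fun=> 1) f 2 cA).
- by move=> n; have [] := bmeasD be0 (ba_ n).
- move=> n x; rewrite /c /e0 /above (le_trans (ler_normD _ _))//.
  by do 2!case: ifP => _; rewrite ?normr1 ?normr0; lra.
- move=> x; apply: cvg_near_cst; rewrite /c /e0.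
  have [kx|kx] := eqVneq (k x) 0.
    apply: nearW => n; rewrite /above kx ifF ?addr0//.
    by apply/negbTE; rewrite -ltNge invr_gt0.
  by apply: filterS (above_near1 k0 kx) => n ->; rewrite add0r.
- by move=> n; rewrite mulL2Dl//; exact: AD.
Qed.

(** This reads [U P = (k o phi) U] on the domain of [P = M_k]. *)
Lemma polar_factor_mult f v : mult mu k f v -> mult mu (k \o phi) (U f) (U v).
Proof.
have mkp : measurable_fun setT (k \o phi) by exact: measurableT_comp.
move=> /(mult_below _ _ mk k0) H; apply/mult_below => //[x|n]; first exact: k0.
rewrite -[below _ n]/(below k n \o phi) -polar_factor_mulL2; last exact: bmeas_below.
by rewrite H polar_factor_mulL2//; exact: bmeas_below_mul.
Qed.

End polar_factor.

Lemma L2dot0r d (X : measurableType d) (R : realType)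
    (mu : {measure set X -> \bar R}) (f : L2 mu) : L2dot mu f 0 = 0.
Proof.
by apply: (addrI (L2dot mu f 0)); rewrite -L2dotDr !addr0.
Qed.

(** The facts about a polar decomposition that the sequel uses, for an operator
    with values in any space with an inner product, once [M_h] is known to be contained in
    [T^* T]. *)
Section polar_of_multiplication.
Context d (X : measurableType d) (R : realType).
Variable mu : {measure set X -> \bar R}.
Variables (K : normedModType R[i]) (dotK : K -> K -> R[i]).
Hypothesis dotK0 : forall x, dotK x 0 = 0.
Variables (T : set (L2 mu * K)) (U : {linear L2 mu -> K}).
Variables (P : set (L2 mu * L2 mu)) (h : X -> R).
Hypothesis TUP : polar_decomposition (L2dot mu) dotK T U P.
Hypotheses (mh : measurable_fun setT h) (h0 : forall x, 0 <= h x).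
Hypothesis hTT : forall f v, mult mu h f v ->
  opcomp (adjoint (L2dot mu) dotK T) T (f, v).

Let k x := Num.sqrt (h x).

Lemma polar_modulus f v : P (f, v) <-> mult mu k f v.
Proof.
have [[Pps PP] _ _ _] := TUP; apply: positive_sqrt_mult => // f' v'.
by rewrite PP; exact: hTT.
Qed.

Lemma polar_factor_graph f v : mult mu k f v -> T (f, U v).
Proof.
have [_ _ _ ->] := TUP.
by move=> /polar_modulus Pfv; exists v.
Qed.

Lemma polar_factor_ker f : mult mu k f 0 -> U f = 0.
Proof.
move=> kf; have [_ _ kerE _] := TUP.
have : ker T f by rewrite /ker/= -(linear0 U); exact: polar_factor_graph.
by rewrite -kerE /ker/graph/=.
Qed.

(** The range of [P] is orthogonal to the kernel of [U], which is the kernel of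
    [T], hence of [P^2], hence of [P]. *)
Lemma polar_factor_isometry f v : mult mu k f v ->
  dotK (U v) (U v) = L2dot mu v v.
Proof.
move=> kfv; have [[_ PP] [_ iso] kerE TE] := TUP; apply: iso => g Ug0.
have Tg : T (g, 0).
  have : ker (graph U) g by rewrite /ker/graph/= Ug0.
  by rewrite kerE.
have : opcomp P P (g, 0).
  by rewrite PP; exists 0 => // p _; rewrite dotK0 L2dot0r.
move=> [s /polar_modulus/= gs /polar_modulus/= s0].
suff s_eq0 : s = 0 by rewrite (dot_mult kfv gs) s_eq0 L2dot0r.
apply/L2_ext/ae_eq_forallP; have := ae_eq_forall (L2repr0 mu); move: gs s0; rewrite /mult.
apply: filterS3 => x sg + zE; rewrite zE => /esym/eqP.
by rewrite mulf_eq0 => /orP[|] /eqP => [k_eq0|->//]; rewrite sg k_eq0 mul0r.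
Qed.

End polar_of_multiplication.

(** * Mean transforms as multiplications *)

(** The index type is [bool] for a pair and [unit] for a single operator. *)
Section mean_transforms.
Context d (X : measurableType d) (R : realType).
Variable mu : {measure set X -> \bar R}.
Variables (I : finType) (phi : I -> X -> X) (U : I -> L2 mu -> L2 mu).
Variables (k : X -> R) (P : set (L2 mu * L2 mu)) (lam : R).
Hypotheses (mk : measurable_fun setT k) (k0 : forall x, 0 <= k x).
Hypothesis mkphi : forall i, measurable_fun setT (k \o phi i).
Hypothesis PE : forall f v, P (f, v) <-> mult mu k f v.
Hypothesis U_mulL2 : forall i (a : X -> R) f, bmeasurable a ->
  U i (mulL2 a f) = mulL2 (a \o phi i) (U i f).
Hypothesis U_mult : forall i f v, mult mu k f v ->
  mult mu (k \o phi i) (U i f) (U i v).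
Hypothesis U_iso : forall f v, mult mu k f v ->
  rnorm v ^+ 2 = \sum_i rnorm (U i v) ^+ 2.
Hypotheses (lam0 : 0 < lam) (lam1 : lam < 1).

(** The truncation [v n] of [k f] is in the range of [P], where [U] is isometric;
    its norm is thus bounded by the norms of the [(k o phi_i) U_i f], uniformly
    in [n], and monotone convergence applies. *)
Lemma mult_modulus_exists f : (forall i, exists g, mult mu (k \o phi i) (U i f) g) ->
  exists v, mult mu k f v.
Proof.
move=> /choice[g Hg].
pose M := \sum_i rnorm (g i) ^+ 2.
pose v n := mulL2 (fun x => below k n x * k x) f.
have vE n : mult mu (fun x => below k n x * k x) f (v n).
  by apply: mulL2P; exact: bmeas_below_mul.
have kv n : mult mu k (mulL2 (below k n) f) (v n).
  have := mulL2P f (bmeas_below mk n); have := vE n; rewrite /mult.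
  by apply: filterS2 => x -> ->; rewrite mulrA -rmorphM [k x * _]mulrC.
have vM n : (sqnorm (v n) <= M%:E)%E.
  rewrite sqnormE (U_iso (kv n)) lee_fin; apply: ler_sum => i _.
  have -> : U i (v n) = mulL2 (below k n \o phi i) (g i).
    rewrite /v U_mulL2; last exact: bmeas_below_mul.
    have bb : bmeasurable (below k n \o phi i).
      exact: (bmeas_below (mkphi i) n).
    apply: mult_mulL2; first exact: (bmeas_below_mul (mkphi i) (fun x => k0 _) n).
    have := mulL2P (g i) bb; have := Hg i; rewrite /mult.
    by apply: filterS2 => x -> ->; rewrite rmorphM mulrA.
  rewrite -lee_fin -!sqnormE -[leRHS]mul1e -[1%E]/(1%:E) -[1%R](expr1n R 2).
  apply: sqnorm_mulL2_le; first exact: (bmeas_below (mkphi i) n).1.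
  by move=> x; rewrite /= /below; case: ifP; rewrite ?normr1 ?normr0.
exists (mulL2 k f); apply/ae_eq_forallP/mkL2E; split.
  by apply: cmeasurable_mul => //; exact: (sqint_repr f).1.
pose F n x := ((below k n x * k x) ^+ 2 * normc (L2repr f x) ^+ 2)%:E.
have mf2 : measurable_fun setT (fun x => normc (L2repr f x) ^+ 2).
  exact/measurable_funX/cmeasurable_normc/(sqint_repr f).1.
have mF n : measurable_fun setT (F n).
  apply/measurable_EFinP; apply: measurable_funM => //; apply: measurable_funX.
  by have [] := bmeas_below_mul mk k0 n.
have F0 n x : (0 <= F n x)%E by rewrite lee_fin mulr_ge0// sqr_ge0.
have ndF x : {homo F^~ x : n m / (n <= m)%N >-> (n <= m)%E}.
  move=> n m nm; rewrite lee_fin ler_wpM2r ?sqr_ge0// ler_pXn2r ?nnegrE//.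
  - rewrite ler_wpM2r// /below; case: ifP => [kn|_]; last by case: ifP.
    by rewrite ifT// (le_trans kn)// ler_nat.
  - by rewrite mulr_ge0// /below; case: ifP.
  - by rewrite mulr_ge0// /below; case: ifP.
have FN n : (\int[mu]_x F n x = sqnorm (v n))%E.
  apply: ge0_ae_eq_integral => //.
  - exact/measurable_normc2/(sqint_repr _).1.
  - by move=> x _; rewrite lee_fin sqr_ge0.
  - apply: filterS (vE n) => x -> _.
    by rewrite normcRM exprMn real_normK ?num_real.
apply: (@le_lt_trans _ _ M%:E); last exact: ltry.
rewrite (eq_integral (fun x => limn (F^~ x))); last first.
  move=> x _; apply/esym/cvg_lim => //; apply: cvg_near_cst.
  have [n nk] : exists n : nat, k x <= n%:R.
    by exists (Num.truncn (k x)).+1; apply/ltW/Num.Theory.real_truncnS_gt/num_real.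
  exists n => // m /= nm; rewrite /F /below ifT ?mul1r.
    by rewrite normcRM exprMn real_normK ?num_real.
  by rewrite (le_trans nk)// ler_nat.
rewrite monotone_convergence//; apply: lime_le.
  apply: ereal_nondecreasing_is_cvgn => n m nm.
  by apply: ge0_le_integral => // x _; exact: ndF.
by apply: nearW => n; rewrite FN.
Qed.

Definition mean_weight i x : R := lam * k (phi i x) + (1 - lam) * k x.

Lemma mean_weight_measurable i : measurable_fun setT (mean_weight i).
Proof. by apply: measurable_funD; apply: measurable_funM => //; exact: mkphi. Qed.

Lemma mean_weight_ge0 i x : 0 <= mean_weight i x.
Proof. by rewrite addr_ge0// mulr_ge0// ?ltW// subr_gt0. Qed.

Lemma mean_transform_mult i f g :
  mean_transform lam%:C (U i) P (f, g) -> mult mu (mean_weight i) (U i f) g.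
Proof.
move=> [ua [ub [/= [a' [a Pfa Ua] uaE] [b [c Uc Pcb] ubE] ->]]].
rewrite /graph/= in Ua Uc uaE ubE *; rewrite Uc in Pcb.
have H1 := U_mult i (iffLR (PE _ _) Pfa); have H2 := iffLR (PE _ _) Pcb.
have lamC : 1 - lam%:C = (1 - lam)%:C by rewrite rmorphB rmorph1.
rewrite uaE ubE Ua lamC; apply: multDl.
- by apply: multM H1 _; exact: mult_cst.
- by apply: multM H2 _; exact: mult_cst.
Qed.

(** The converse needs all components at once: [f] is in the domain of [P]
    only if each [(k o phi_i) U_i f] is square integrable. *)
Lemma mult_mean_transform f (g : I -> L2 mu) :
  (forall i, mult mu (mean_weight i) (U i f) (g i)) ->
  forall i, mean_transform lam%:C (U i) P (f, g i).
Proof.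
move=> Hg.
have l1 : 0 < 1 - lam by rewrite subr_gt0.
(* each of the two terms of the weight is dominated by the weight itself *)
have bnd (c r s t : R) (z : R[i]) : 0 < c -> 0 <= r -> 0 <= s -> 0 <= t ->
    normc (r%:C * z) <= normc ((c^-1)%:C * ((c * r + s * t)%:C * z)).
  move=> c0 r0 s0 t0; rewrite !normcRM mulrA -normrM ler_wpM2r ?normc_ge0//.
  have -> : c^-1 * (c * r + s * t) = r + c^-1 * (s * t).
    by rewrite mulrDr mulKf// gt_eqF.
  have st0 : 0 <= c^-1 * (s * t) by rewrite !mulr_ge0// invr_ge0 ltW.
  by rewrite !ger0_norm ?addr_ge0// lerDl.
have [v kfv] : exists v, mult mu k f v.
  apply: mult_modulus_exists => i.
  apply: (@mult_exists _ _ _ _ _ _ ((lam^-1)%:C *: g i)) => //.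
  have := ae_eq_forall (L2reprZ (lam^-1)%:C (g i)); have := Hg i; rewrite /mult.
  by apply: filterS2 => x -> ->; apply: bnd => //; rewrite ?k0 // ltW.
move=> i.
have [b kb] : exists b, mult mu k (U i f) b.
  apply: (@mult_exists _ _ _ _ _ _ (((1 - lam)^-1)%:C *: g i)) => //.
  have := ae_eq_forall (L2reprZ ((1 - lam)^-1)%:C (g i)); have := Hg i; rewrite /mult.
  apply: filterS2 => x -> ->; rewrite /mean_weight [lam * _ + _]addrC.
  by apply: bnd => //; rewrite ?k0 // ltW.
exists (lam%:C *: U i v), ((1 - lam)%:C *: b); split => /=.
- by exists (U i v) => //; exists v => //; apply/PE.
- exists b; last by rewrite rmorphB rmorph1.
  by exists (U i f) => //; apply/PE.
- apply: mult_functional (Hg i) _; apply: multDl.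
  + by apply: multM (U_mult i kfv) _; exact: mult_cst.
  + by apply: multM kb _; exact: mult_cst.
Qed.

End mean_transforms.

Theorem corollary22 (R : realType) (d : measure_display)
    (X : measurableType d) (mu : {sigma_finite_measure set X -> \bar R})
    (phi phi1 phi2 : X -> X) (w w1 w2 : X -> R[i]) (lam : R)
    (hC : wco_symbol mu phi w)
    (hC1 : wco_symbol mu phi1 w1)
    (hC2 : wco_symbol mu phi2 w2)
    (dC : densely_defined (wco mu phi w))
    (dC1 : densely_defined (wco mu phi1 w1))
    (dC2 : densely_defined (wco mu phi2 w2))
    (lam0 : 0 < lam) (lam1 : lam < 1) :
  (forall (U : {linear L2 mu -> (L2 mu * L2 mu)%type})
      (P : set (L2 mu * L2 mu)),
    polar_decomposition (L2dot mu) (L2dot2 mu)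
      (column (wco mu phi1 w1) (wco mu phi2 w2)) U P ->
    closed (spherical_mean_transform lam%:C U P)) /\
  (forall (U : {linear L2 mu -> L2 mu}) (P : set (L2 mu * L2 mu)),
    polar_decomposition (L2dot mu) (L2dot mu)
      (wco mu phi w) U P ->
    closed (mean_transform lam%:C U P)).

Proof.
have fstC (A B : topologicalType) : continuous (fst : A * B -> A) by move=> x; exact: cvg_fst.
have sndC (A B : topologicalType) : continuous (snd : A * B -> B) by move=> x; exact: cvg_snd.
split=> U P TUP.
- have [h1 dh1] := composition_density_exists hC1 dC1.
  have [h2 dh2] := composition_density_exists hC2 dC2.
  have [mh1 h10 _] := dh1; have [mh2 h20 _] := dh2.
  pose h x := h1 x + h2 x.
  have mh : measurable_fun setT h by exact: measurable_funD.
  have h0 x : 0 <= h x by rewrite addr_ge0.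
  have hTT := column_mult_sub hC1 hC2 dh1 dh2.
  have dot0 : forall x, L2dot2 mu x 0 = 0 by move=> x; rewrite /L2dot2 !L2dot0r addr0.
  pose k x := Num.sqrt (h x).
  have mk : measurable_fun setT k by exact: measurable_sqrt.
  have k0 x : 0 <= k x by exact: sqrtr_ge0.
  have cU : continuous U by case: TUP => _ [].
  pose phi_ (i : bool) := if i then phi1 else phi2.
  pose w_ (i : bool) := if i then w1 else w2.
  pose U_ (i : bool) f := if i then (U f).1 else (U f).2.
  have hC_ i : wco_symbol mu (phi_ i) (w_ i) by case: i.
  have cU_ i : continuous (U_ i).
    case: i => f; first by apply: (@continuous_comp _ _ _ U fst); [exact: cU|exact: fstC].
    by apply: (@continuous_comp _ _ _ U snd); [exact: cU|exact: sndC].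
  have UD_ i f g : U_ i (f + g) = U_ i f + U_ i g by case: i; rewrite /U_ linearD.
  have UC_ i f v : mult mu k f v -> wco mu (phi_ i) (w_ i) (f, U_ i v).
    by move=> /(polar_factor_graph TUP mh h0 hTT)[/= ? ?]; case: i.
  have U0_ i f : mult mu k f 0 -> U_ i f = 0.
    by move=> /(polar_factor_ker TUP mh h0 hTT); case: i; rewrite /U_ => ->.
  have PE := polar_modulus TUP mh h0 hTT.
  have Umul i := polar_factor_mulL2 (hC_ i) mk k0 (UD_ i) (@cU_ i) (@UC_ i) (@U0_ i).
  have Umult i := polar_factor_mult (hC_ i) mk k0 (UD_ i) (@cU_ i) (@UC_ i) (@U0_ i).
  have mkphi i : measurable_fun setT (k \o phi_ i).
    by apply: measurableT_comp => //; case: (hC_ i).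
  have Uiso f v : mult mu k f v -> rnorm v ^+ 2 = \sum_i rnorm (U_ i v) ^+ 2.
    move=> /(polar_factor_isometry dot0 TUP mh h0 hTT) iso.
    by rewrite big_bool -!rdot_self /rdot -iso /L2dot2 raddfD.
  pose m i := mean_weight phi_ k lam i.
  have mm i : measurable_fun setT (m i) by exact: mean_weight_measurable.
  have m0 i x : 0 <= m i x by exact: mean_weight_ge0.
  have cl i (pr : L2 mu * L2 mu -> L2 mu) : continuous pr ->
      closed [set p : L2 mu * (L2 mu * L2 mu) |
        mult mu (m i) (U_ i p.1) (pr p.2)].
    move=> cpr; apply: closed_mult => // p.
      by apply: (@continuous_comp _ _ _ fst (U_ i)); [exact: fstC|exact: cU_].
    by apply: (@continuous_comp _ _ _ snd pr); [exact: sndC|exact: cpr].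
  rewrite (_ : spherical_mean_transform _ _ _ =
    [set p | mult mu (m true) (U_ true p.1) p.2.1] `&`
    [set p | mult mu (m false) (U_ false p.1) p.2.2]).
    by apply: closedI; [exact: (cl true fst (fstC _ _))|exact: (cl false snd (sndC _ _))].
  apply/seteqP; split=> [[f [g1 g2]]|[f [g1 g2]]] /=.
    move=> [/= H1 H2]; split.
      exact: (mean_transform_mult (i := true) PE Umult H1).
    exact: (mean_transform_mult (i := false) PE Umult H2).
  move=> [/= H1 H2].
  pose g (i : bool) := if i then g1 else g2.
  have Hg i : mult mu (m i) (U_ i f) (g i) by case: i.
  have H := mult_mean_transform mk k0 mkphi PE Umul Umult Uiso lam0 lam1 Hg.
  by split; [exact: (H true)|exact: (H false)].
- have [h dh] := composition_density_exists hC dC.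
  have [mh h0 _] := dh.
  have hTT := wco_mult_sub hC dh.
  have dot0 : forall x, L2dot mu x 0 = 0 by exact: L2dot0r.
  pose k x := Num.sqrt (h x).
  have mk : measurable_fun setT k by exact: measurable_sqrt.
  have k0 x : 0 <= k x by exact: sqrtr_ge0.
  have cU : continuous U by case: TUP => _ [].
  have UD f g : U (f + g) = U f + U g by rewrite linearD.
  have UC f v : mult mu k f v -> wco mu phi w (f, U v).
    by move/(polar_factor_graph TUP mh h0 hTT).
  have U0 f : mult mu k f 0 -> U f = 0.
    by move/(polar_factor_ker TUP mh h0 hTT).
  have PE := polar_modulus TUP mh h0 hTT.
  pose U_ (i : unit) f := U f.
  have Umul (i : unit) := polar_factor_mulL2 hC mk k0 UD cU UC U0.
  have Umult (i : unit) := polar_factor_mult hC mk k0 UD cU UC U0.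
  have mkphi (i : unit) : measurable_fun setT (k \o phi).
    by apply: measurableT_comp => //; case: hC.
  have Uiso f v : mult mu k f v -> rnorm v ^+ 2 = \sum_(i : unit) rnorm (U_ i v) ^+ 2.
    move=> /(polar_factor_isometry dot0 TUP mh h0 hTT) iso.
    by rewrite (big_pred1 tt) => [|[]//]; rewrite -!rdot_self /rdot -iso.
  pose m := mean_weight (fun=> phi) k lam tt.
  rewrite (_ : mean_transform _ _ _ = [set p | mult mu m (U p.1) p.2]).
    apply: (closed_mult (F := fun p => U p.1) (G := snd)) => [||p|p].
    - exact: (mean_weight_measurable _ mk mkphi).
    - exact: mean_weight_ge0.
    - by apply: (@continuous_comp _ _ _ fst U); [exact: fstC|exact: cU].
    - exact: sndC.
  apply/seteqP; split=> [[f g]|[f g]] /= H.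
    exact: (mean_transform_mult (i := tt) (U := U_) PE Umult H).
  exact: (mult_mean_transform (U := U_) mk k0 mkphi PE Umul Umult Uiso lam0 lam1
    (g := fun=> g) (fun=> H) tt).
Qed.
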